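(* Let $n\geq 1$, let $0\leq l\leq n$, and let $z_{ij}\in\mathbb{T}$ for all $i\neq j$ with $1\leq i,j\leq n$ be such that $z_{ji}=\overline{z_{ij}}$. Then the $C^*$-algebra $\mathcal A_{\{z_{ij}\};l,n-l}$ is nuclear.
   Context: $\mathbb{T}$ is the unit circle in $\mathbb{C}$. $\mathcal A_{\{z_{ij}\};l,n-l}$ denotes the universal unital $C^*$-algebra generated by elements $s_1,\dotsc,s_n$ such that $s_i^*s_j=\overline{z_{ij}}\,s_js_i^*$ and $s_is_j=z_{ij}s_js_i$ for all $i\neq j$, $s_i^*s_i=1$ for $i=1,\dotsc,l$, and $s_i^*s_i=s_is_i^*=1$ for $i=l+1,\dotsc,n$. *)

(* Defs.v *)
From HB Require Import structures.
From mathcomp Require Import all_boot all_order all_algebra.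
From mathcomp Require Import complex.
From mathcomp Require Import reals.

Set Implicit Arguments.
Unset Strict Implicit.
Unset Printing Implicit Defensive.

Import Order.TTheory GRing.Theory Num.Theory.

Local Open Scope ring_scope.

Definition cabs (R : realType) (c : R[i]) : R := complex.Re `|c|.

(* Unital C*-algebras.  The norm is real valued and carried by the structure:
   the library's normed modules over R[i] and its algebras have no common
   substructure that HB can join.  [algType] carries the axiom 1 != 0: the zero
   algebra is excluded, which changes neither the universal property below
   (maps to 0 exist trivially) nor its solution (which is nonzero). *)
HB.mixin Record isCStarAlgebra (R : realType) A of GRing.Algebra R[i] A := {
  star : A -> A;
  cnorm : A -> R;
  starK : forall x : A, star (star x) = x;
  starD : forall x y : A, star (x + y) = star x + star y;
  starZ : forall (c : R[i]) (x : A), star (c *: x) = Num.conj c *: star x;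
  starM : forall x y : A, star (x * y) = star y * star x;
  cnorm_eq0 : forall x : A, cnorm x = 0 -> x = 0;
  cnormD : forall x y : A, cnorm (x + y) <= cnorm x + cnorm y;
  cnormZ : forall (c : R[i]) (x : A), cnorm (c *: x) = cabs c * cnorm x;
  cnormM : forall x y : A, cnorm (x * y) <= cnorm x * cnorm y;
  cnorm_cstar : forall x : A, cnorm (star x * x) = cnorm x ^+ 2;
  cnorm_complete : forall u : nat -> A,
    (forall e : R, 0 < e -> exists N : nat,
       forall m p : nat, (N <= m)%N -> (N <= p)%N -> cnorm (u m - u p) < e) ->
    exists x : A, forall e : R, 0 < e -> exists N : nat,
       forall m : nat, (N <= m)%N -> cnorm (u m - x) < e
}.

#[short(type="cstarAlgType")]
HB.structure Definition CStarAlgebra (R : realType) :=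
  { A of GRing.Algebra R[i] A & isCStarAlgebra R A }.

Section Universal.
Variable R : realType.

(* The index i : 'I_n stands for i + 1 in 1, ..., n, so that i < l singles out
   s_1, ..., s_l. *)
Definition twisted_relations (n l : nat) (z : 'I_n -> 'I_n -> R[i])
    (A : cstarAlgType R) (s : 'I_n -> A) : Prop :=
  [/\ forall i j : 'I_n, i != j ->
        star (s i) * s j = Num.conj (z i j) *: (s j * star (s i)),
      forall i j : 'I_n, i != j -> s i * s j = z i j *: (s j * s i),
      forall i : 'I_n, (i < l)%N -> star (s i) * s i = 1 &
      forall i : 'I_n, (l <= i)%N ->
        star (s i) * s i = 1 /\ s i * star (s i) = 1].

(* Every unital *-subalgebra containing the s_i is norm dense. *)
Definition cstar_generated (n : nat) (A : cstarAlgType R) (s : 'I_n -> A) :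
    Prop :=
  forall S : A -> Prop,
    S 1 ->
    (forall x y, S x -> S y -> S (x + y)) ->
    (forall x y, S x -> S y -> S (x * y)) ->
    (forall (c : R[i]) x, S x -> S (c *: x)) ->
    (forall x, S x -> S (star x)) ->
    (forall i, S (s i)) ->
  forall (a : A) (e : R), 0 < e -> exists2 b : A, S b & cnorm (a - b) < e.

(* (A, s) is the universal unital C*-algebra on the relations; this determines
   it up to a unique *-isomorphism. *)
Definition is_universal_twisted (n l : nat) (z : 'I_n -> 'I_n -> R[i])
    (A : cstarAlgType R) (s : 'I_n -> A) : Prop :=
  [/\ twisted_relations l z s,
      cstar_generated s &
      forall (B : cstarAlgType R) (t : 'I_n -> B), twisted_relations l z t ->
        exists f : {lrmorphism A -> B},
          (forall x, f (star x) = star (f x)) /\ (forall i, f (s i) = t i)].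

End Universal.

Section Nuclear.

Definition mx_star (T : pzRingType) (st : T -> T) m n (X : 'M[T]_(m, n)) :
    'M[T]_(n, m) := map_mx st X^T.

Definition mx_positive (T : pzRingType) (st : T -> T) m (X : 'M[T]_m) : Prop :=
  exists Y : 'M[T]_m, X = mx_star st Y *m Y.

Definition completely_positive (T U : pzRingType) (stT : T -> T) (stU : U -> U)
    (f : T -> U) : Prop :=
  forall (m : nat) (X : 'M[T]_m),
    mx_positive stT X -> mx_positive stU (map_mx f X).

Variable R : realType.

Definition cmx_star k (M : 'M[R[i]]_k) : 'M[R[i]]_k :=
  mx_star (fun c : R[i] => Num.conj c) M.

(* For 0 <= c: the C*-norm of M, that is its operator norm on the Hilbert space
   C^k, is at most c. *)
Definition cmx_norm_le k (M : 'M[R[i]]_k) (c : R) : Prop :=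
  forall v : 'cV[R[i]]_k,
    \sum_i cabs ((M *m v) i 0) ^+ 2 <= c ^+ 2 * \sum_i cabs (v i 0) ^+ 2.

(* Nuclearity as defined in Brown and Ozawa, "C*-Algebras and
   Finite-Dimensional Approximations", Definitions 2.1.1 and 2.3.1: the
   identity of A is a point-norm limit of maps psi \o phi, where
   phi : A -> M_k(C) and psi : M_k(C) -> A are contractive and completely
   positive.  The net is indexed by the pairs (F, e). *)
Definition nuclear (A : cstarAlgType R) : Prop :=
  forall (F : seq A) (e : R), 0 < e ->
    exists (k : nat) (phi : {linear A -> 'M[R[i]]_k})
           (psi : {linear 'M[R[i]]_k -> A}),
      [/\ completely_positive (@star R A) (@cmx_star k) phi,
          forall a : A, cmx_norm_le (phi a) (cnorm a),
          completely_positive (@cmx_star k) (@star R A) psi,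
          forall (M : 'M[R[i]]_k) (c : R),
            0 <= c -> cmx_norm_le M c -> cnorm (psi M) <= c &
          forall a : A, a \in F -> cnorm (psi (phi a) - a) < e].

End Nuclear.

(* Main.v *)
(* Let A be generated by isometries s_1, ..., s_n with the twisted relations; a
   unitary s_i is an isometry whose defect projection p_i = 1 - s_i s_i^* is 0.
   For a set J of indices, let D be the product of the p_j with j in J.
   Averaging over the gauge automorphisms s_i -> w_i s_i, compressing by the
   isometry prod_(i notin J) s_i^N and by D, and letting N tend to infinity
   sends every a in A to a multiple tau_J(a) D of D; this defines a state with
   tau_J(s^a s^b^* ) = 1 if a = b vanishes on J, and 0 otherwise.

   For each i choose a cut c_i in [2N, 3N) and a side of it.  Below the cut
   (i in J) s_i is compressed to the range of 1 - s_i^c s_i^*c, where it is a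
   matrix of size c; above the cut (i notin J) it is treated as a unitary, with
   Fejer averages over the positions f_i in [N, 2N).  The matrices
   phi(a)_(f,g) = tau_J(s^f^* a s^g) and the rows V_f, multiples of
   (prod_(i notin J) s_i^c_i s_i^*c_i) s^f D, give the factorization
   a |-> sum_(f,g) phi(a)_(f,g) V_f V_g^*, averaged over all cuts.  It sends
   s^a s^b^* to s^a s^b^* times a product over i of averages of projections
   s_i^c s_i^*c, which telescope to 1 + O(1/N). *)
Require Import Defs.
From HB Require Import structures.
From mathcomp Require Import all_boot all_order all_algebra.
From mathcomp Require Import complex.
From mathcomp Require Import boolp classical_sets.
From mathcomp Require Import reals.
From mathcomp Require Import sesquilinear spectral.
From mathcomp Require Import zify ring lra.

Set Implicit Arguments.
Unset Strict Implicit.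
Unset Printing Implicit Defensive.

Import Order.TTheory GRing.Theory Num.Theory.

Local Open Scope complex_scope.
Local Open Scope ring_scope.

(** A single truncation of an isometry fails to commute with it by a projection of norm 1 at its
    edge; averaging over N cuts makes these errors telescope. The part of s_i above a cut is not
    captured by a finite matrix; there the positions in [N, 2N) serve as a Folner set for a unitary.
    Cuts start at 2N so that these positions lie below every cut and the projection above the cut
    does not depend on them. Positions start at N so that a power of s_i^* with exponent at most N
    never exhausts them.

    Only the moduli of the z_ij matter: monomials are handled up to a phase, and the phases cancel
    in the factorization. Universality enters through the gauge automorphisms, generation through
    the density of the span of the monomials.

    Positivity is developed without spectra or representations, from square roots obtained by a norm
    convergent iteration. The same iteration is run for matrices over A, with operator bounds on the
    Hilbert module A^m in place of a norm, because complete positivity asks for a square factor Y in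
    X = Y^* Y. *)

(** * Square roots by iteration *)

Section Rates.

Variable R : realType.

(** A majorant of 1 - r_k for the scalar iteration below. The map a -> (1 + a^2)/2 has the double
    fixed point 1, so the convergence is of order 1/k and not geometric. It then serves as the
    standard modulus of convergence. *)
Definition rate (k : nat) : R := 2 / k.+2%:R.

Lemma rate_ge0 k : 0 <= rate k.
Proof. by rewrite divr_ge0. Qed.

Lemma rate0 : rate 0 = 1.
Proof. by rewrite /rate divff ?pnatr_eq0. Qed.

Lemma rateS_le k : rate k.+1 <= rate k.
Proof. by rewrite ler_pM2l ?ltr0n // lef_pV2 ?posrE ?ltr0n // ler_nat. Qed.

Definition sqrt_iter k : R := iter k (fun a => 2^-1 * (1 + a * a)) 0.

Lemma sqrt_iter_bounds k (r := sqrt_iter) :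
  [/\ 0 <= r k, r k <= 1, r k <= r k.+1 & 1 - r k <= rate k].
Proof.
have rS m : r m.+1 = 2^-1 * (1 + r m * r m) by [].
have rmono m : r m <= r m.+1.
  rewrite rS {rS}; move: (r m) => y; have := sqr_ge0 (1 - y); rewrite expr2; lra.
suff: [/\ 0 <= r k, r k <= 1 & 1 - r k <= rate k] by case=> *; split.
elim: k => [|k [r0 r1 rk]]; first by rewrite /rate /r /= divff ?pnatr_eq0 ?subr0 ?lexx ?ler01.
split; first exact: le_trans (rmono k).
  by rewrite rS {rS rmono}; move: (r k) r0 r1 => y; nra.
have -> : 1 - r k.+1 = (1 - r k) - 2^-1 * (1 - r k) ^+ 2 by rewrite rS; field.
move: rk r0 r1 {rS rmono}; set t := 1 - r k => rk r0 r1.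
have t1 : t <= 1 by rewrite /t; lra.
have k2 : (0 : R) < k.+2%:R by rewrite ltr0n.
have k3 : (0 : R) < k.+3%:R by rewrite ltr0n.
have d1 : rate k <= 1 by rewrite ler_pdivrMr // mul1r ler_nat.
(* t - t^2/2 increases on [0, 1], so t may be replaced by its bound [rate k]. What remains is 2/(y +
   1) - 2/y + 2/y^2 = 2/(y^2 (y + 1)) with y = k + 2. *)
apply: (@le_trans _ _ (rate k - 2^-1 * rate k ^+ 2)).
  have t0 : 0 <= t by rewrite subr_ge0.
  have := rate_ge0 k; move: (rate k) rk d1 => d; nra.
rewrite /rate.
have k3E : k.+3%:R = k.+2%:R + 1 :> R by rewrite -natr1.
rewrite k3E in k3 *; move: (k.+2%:R : R) k2 k3 => y y0 y1.
rewrite -subr_ge0.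
have -> : 2 / (y + 1) - (2 / y - 2^-1 * (2 / y) ^+ 2) = 2 / (y ^+ 2 * (y + 1)).
  by field; rewrite !gt_eqF.
by rewrite divr_ge0 // mulr_ge0 ?ltW // exprn_gt0.
Qed.

End Rates.

Section SqrtIteration.

(* [bnd x c] stands for ||x|| <= c: it is the norm of a C*-algebra in
   [cnorm_sqrt] and the operator bound [mbnd] of matrices over a C*-algebra in
   [mx_square_root]. *)
Variables (R : realType) (B : pzRingType) (h : B) (bnd : B -> R -> Prop).

Local Notation rate := (rate R).

Hypothesis hh : h + h = 1.
Hypothesis bnd0 : bnd 0 0.
Hypothesis bndN : forall x c, bnd x c -> bnd (- x) c.
Hypothesis bnd_le : forall x (c d : R), 0 <= c -> c <= d -> bnd x c -> bnd x d.
Hypothesis bndD : forall x y (c d : R), 0 <= c -> 0 <= d -> bnd x c -> bnd y d ->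
  bnd (x + y) (c + d).
Hypothesis bndM : forall x y (c d : R), 0 <= c -> 0 <= d -> bnd x c -> bnd y d ->
  bnd (x * y) (c * d).
Hypothesis bndh : bnd h 2^-1.
Hypothesis bnd_sep : forall x, (forall k, bnd x (2 * rate k)) -> x = 0.
Hypothesis bnd_complete : forall u : nat -> B,
  (forall k p, bnd (u (k + p)%N - u k) (rate k)) ->
  exists x, forall k, bnd (u k - x) (rate k).

Variable x : B.
Hypothesis bndx : bnd x 1.

Let w k := iter k (fun a => h * (x + a * a)) 0.
Local Notation r := (sqrt_iter R).
Let r_bounds := sqrt_iter_bounds R.

Let bndw k : bnd (w k) (r k).
Proof.
elim: k => [|k IH] //=; have [r0 _ _ _] := r_bounds k.
by apply: bndM => //; [lra|nra|apply: bndD => //; [nra|exact: bndM]].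
Qed.

Let sqr_sub (a b : B) : a * a - b * b = a * (a - b) + (a - b) * b.
Proof. by rewrite mulrBr mulrBl addrA subrK. Qed.

Let bndwS k : bnd (w k.+1 - w k) (r k.+1 - r k).
Proof.
elim: k => [|k IH].
  rewrite /= subr0 /r /= subr0; apply: bndM => //; [lra|lra|].
  by rewrite mulr0 addr0 mulr0 addr0.
have [r0 _ rle _] := r_bounds k; have [r0' _ _ _] := r_bounds k.+1.
have -> : w k.+2 - w k.+1 = h * (w k.+1 * (w k.+1 - w k) + (w k.+1 - w k) * w k).
  by rewrite -sqr_sub [w k.+2]/= [w k.+1 in X in _ - X]/= -/(w _) -mulrBr opprD addrACA subrr add0r.
have -> : r k.+2 - r k.+1 =
    2^-1 * (r k.+1 * (r k.+1 - r k) + (r k.+1 - r k) * r k).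
  have rS m : r m.+1 = 2^-1 * (1 + r m * r m) by [].
  by rewrite [r k.+2]rS [X in _ - X = _]rS; field.
have d0 : 0 <= r k.+1 - r k by rewrite subr_ge0.
apply: bndM => //; first by lra.
  by rewrite addr_ge0 // mulr_ge0.
have bS := bndw k.+1; have b0 := bndw k.
  by apply: bndD; [exact: mulr_ge0|exact: mulr_ge0|exact: bndM|exact: bndM].
Qed.

Let bndw_diff k p : bnd (w (k + p)%N - w k) (r (k + p)%N - r k) /\ r k <= r (k + p)%N.
Proof.
elim: p => [|p [IH IHr]]; first by rewrite addn0 !subrr.
have [_ _ rle _] := r_bounds (k + p); rewrite addnS; split; last exact: le_trans rle.
have -> : w (k + p).+1 - w k = (w (k + p).+1 - w (k + p)%N) + (w (k + p)%N - w k).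
  by rewrite addrA subrK.
have -> : r (k + p).+1 - r k = (r (k + p).+1 - r (k + p)%N) + (r (k + p)%N - r k).
  by rewrite addrA subrK.
by apply: bndD; rewrite ?subr_ge0.
Qed.

(* The fixed point of a = (x + a^2)/2 is 1 - sqrt (1 - x).  The increments of
   the iteration are dominated by those of the scalar one started from x = 1. *)
Lemma sqrt_iteration :
  exists v, [/\ (1 - v) * (1 - v) = 1 - x, bnd v 1 &
    forall P : B -> Prop, P 0 -> (forall a, P a -> P (h * (x + a * a))) ->
      (forall a, (forall k, exists2 b, P b & bnd (b - a) (rate k)) -> P a) ->
      P v].
Proof.
have [v vP] : exists v, forall k, bnd (w k - v) (rate k).
  apply: bnd_complete => k p; have [bw rle] := bndw_diff k p.
  apply: bnd_le bw; first by rewrite subr_ge0.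
  have [_ _ _ rk] := r_bounds k; have [_ r1 _ _] := r_bounds (k + p).
  by apply: le_trans rk; rewrite lerB.
have v1 : bnd v 1.
  rewrite -[v]opprK; apply: bndN; have := vP 0%N; rewrite sub0r.
  by rewrite rate0.
exists v; split=> //; last first.
  move=> P P0 Ps Pl; apply: Pl => k; exists (w k) => //.
  by elim: k => //= k; apply: Ps.
(* Both sides are within [rate k] of the iterate k + 1, whence the factor 2 in [bnd_sep]. *)
have vE : h * (x + v * v) = v.
  apply/eqP; rewrite -subr_eq0; apply/eqP/bnd_sep => k.
  have -> : h * (x + v * v) - v =
      - (h * (w k * (w k - v) + (w k - v) * v)) + (w k.+1 - v).
    by rewrite -sqr_sub addrA -mulrN opprB [w k.+1]/= -/(w k) -mulrDr addrCA subrK.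
  rewrite mulr_natl mulr2n; have d0 := rate_ge0 R k; have [r0 r1 _ _] := r_bounds k.
  apply: bndD => //; last by apply: bnd_le (vP _); rewrite ?rate_ge0 ?rateS_le.
  apply: bndN; apply: (@bnd_le _ (2^-1 * (1 * rate k + rate k * 1))); [nra|lra|].
  apply: bndM => //; [lra|nra|apply: bndD; [nra|nra| |exact: bndM]].
  by apply: bndM => //; apply: bnd_le (bndw k).
have e2 : v + v = x + v * v.
  by rewrite -{1 2}vE -mulrDl hh mul1r.
by rewrite mulrBl mul1r mulrBr mulr1 -[1 - v - _]addrA -opprD addrA e2 addrK.
Qed.

End SqrtIteration.

(** * Elementary C*-algebra *)

Section ComplexScalars.

Variable R : realType.

Lemma cabs_norm (c : R[i]) : (cabs c)%:C = `|c|.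
Proof. by rewrite /cabs RRe_real // normr_real. Qed.

Lemma cabs_real (r : R) : cabs r%:C = `|r|.
Proof. by rewrite /cabs normc_def /= expr0n addr0 sqrtr_sqr. Qed.

Lemma cabs_unit (c : R[i]) : `|c| = 1 -> cabs c = 1.
Proof. by rewrite /cabs => ->. Qed.

Lemma cabs_sqr (c : R[i]) : (cabs c ^+ 2)%:C = c * Num.conj c.
Proof. by rewrite rmorphXn /= cabs_norm -normCK. Qed.

Lemma cabs_ge0 (c : R[i]) : 0 <= cabs c.
Proof. by rewrite -ler0c cabs_norm. Qed.

Lemma conj_real (r : R) : Num.conj r%:C = r%:C.
Proof. by apply/conj_Creal/complex_realP; exists r. Qed.

Lemma rate_small (e : R) : 0 < e ->
  exists N, forall m, (N <= m)%N -> rate R m < e.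
Proof.
move=> e0; exists (Num.bound (2 / e)) => m Nm.
rewrite ltr_pdivrMr ?ltr0n // mulrC -ltr_pdivrMr //.
apply: lt_le_trans (archi_boundP _) _; first by rewrite divr_ge0 // ltW.
by rewrite ler_nat (leq_trans Nm) // -addn2 leq_addr.
Qed.

Lemma le_small (x y : R) (C : R) :
  (forall e, 0 < e -> x <= y + C * e) -> x <= y.
Proof.
move=> H; have C1 : 0 < `|C| + 1 by rewrite ltr_wpDl.
apply/ler_addgt0Pr => e e0.
apply: le_trans (H (e / (`|C| + 1)) _) _; first by rewrite divr_gt0.
rewrite lerD2l mulrCA ger_pMr // ler_pdivrMr // mul1r.
by rewrite (le_trans (ler_norm C)) // lerDl.
Qed.

End ComplexScalars.

Section CStarBasics.

Variables (R : realType) (A : cstarAlgType R).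
Implicit Types (x y h : A) (r t : R).

Lemma star0 : star (0 : A) = 0.
Proof. by apply: (addIr (star 0)); rewrite add0r -starD addr0. Qed.

Lemma starN x : star (- x) = - star x.
Proof. by apply: (addIr (star x)); rewrite -starD !addNr star0. Qed.

Lemma starB x y : star (x - y) = star x - star y.
Proof. by rewrite starD starN. Qed.

Lemma star1 : star (1 : A) = 1.
Proof. by rewrite -[LHS]mulr1 -{2}[1]starK -starM mulr1 starK. Qed.

Lemma star_sum (I : Type) (s : seq I) (P : pred I) (F : I -> A) :
  star (\sum_(i <- s | P i) F i) = \sum_(i <- s | P i) star (F i).
Proof. by apply: big_morph; [exact: starD|exact: star0]. Qed.

Lemma starX x k : star (x ^+ k) = star x ^+ k.
Proof. by elim: k => [|k IH]; rewrite ?expr0 ?star1 // exprS exprSr starM IH. Qed.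

Lemma starR r x : star (r%:C *: x) = r%:C *: star x.
Proof. by rewrite starZ conj_real. Qed.

Lemma star_alg (r : R) : star (r%:C%:A : A) = r%:C%:A.
Proof. by rewrite starR star1. Qed.

Lemma cnorm0 : cnorm (0 : A) = 0.
Proof. by rewrite -(scale0r (0 : A)) cnormZ (cabs_real 0) normr0 mul0r. Qed.

Lemma cnormR r x : cnorm (r%:C *: x) = `|r| * cnorm x.
Proof. by rewrite cnormZ cabs_real. Qed.

Lemma cnormN x : cnorm (- x) = cnorm x.
Proof.
have -> : - x = (- 1)%:C *: x by rewrite rmorphN1 scaleN1r.
by rewrite cnormR normrN1 mul1r.
Qed.

Lemma cnorm_ge0 x : 0 <= cnorm x.
Proof. by have := cnormD x (- x); rewrite subrr cnorm0 cnormN; lra. Qed.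

Lemma cnormB x y : cnorm (x - y) = cnorm (y - x).
Proof. by rewrite -cnormN opprB. Qed.

Lemma cnorm_sub x y : cnorm (x - y) <= cnorm x + cnorm y.
Proof. by rewrite -[cnorm y]cnormN cnormD. Qed.

Lemma cnorm_dist x y z : cnorm (x - z) <= cnorm (x - y) + cnorm (y - z).
Proof.
have -> : x - z = (x - y) + (y - z) by rewrite addrA subrK.
exact: cnormD.
Qed.

Lemma cnorm_sum (I : Type) (s : seq I) (P : pred I) (F : I -> A) :
  cnorm (\sum_(i <- s | P i) F i) <= \sum_(i <- s | P i) cnorm (F i).
Proof.
elim/big_rec2: _ => [|i b a _ IH]; first by rewrite cnorm0.
by apply: le_trans (cnormD _ _) _; rewrite lerD2l.
Qed.

Lemma cnorm_star x : cnorm (star x) = cnorm x.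
Proof.
have le y : cnorm y <= cnorm (star y).
  have [->|y0] := eqVneq (cnorm y) 0; first exact: cnorm_ge0.
  have yp : 0 < cnorm y by rewrite lt0r y0 cnorm_ge0.
  by rewrite -(ler_pM2r yp) -expr2 -cnorm_cstar cnormM.
by apply/eqP; rewrite eq_le le andbT; have := le (star x); rewrite starK.
Qed.

Lemma cnorm_star_mul x : cnorm (x * star x) = cnorm x ^+ 2.
Proof. by rewrite -{1}[x]starK cnorm_cstar cnorm_star. Qed.

Lemma cnorm_sqr h : star h = h -> cnorm (h * h) = cnorm h ^+ 2.
Proof. by move=> hs; rewrite -{1}hs cnorm_cstar. Qed.

Lemma cnorm1 : cnorm (1 : A) = 1.
Proof.
have /eqP := cnorm_sqr star1; rewrite mulr1 eq_sym -subr_eq0 expr2 -{3}[cnorm 1]mulr1 -mulrBr.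
rewrite mulf_eq0 subr_eq0 => /orP[/eqP/cnorm_eq0/eqP|/eqP //].
by rewrite oner_eq0.
Qed.

Lemma cnorm_alg r : cnorm (r%:C%:A : A) = `|r|.
Proof. by rewrite cnormR cnorm1 mulr1. Qed.

Lemma half_alg : (2^-1 : R)%:C%:A + (2^-1 : R)%:C%:A = 1 :> A.
Proof.
rewrite -scalerDl -rmorphD /= (_ : 2^-1 + 2^-1 = 1 :> R) ?scale1r //.
by field.
Qed.

Definition ccvg (u : nat -> A) x := forall e : R, 0 < e ->
  exists N : nat, forall m, (N <= m)%N -> cnorm (u m - x) < e.

Lemma cauchy_rate (u : nat -> A) :
  (forall k p, cnorm (u (k + p)%N - u k) <= rate R k) ->
  exists2 x, ccvg u x & forall k, cnorm (u k - x) <= rate R k.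
Proof.
move=> uC.
have ud m p N : (N <= m)%N -> (N <= p)%N -> cnorm (u m - u p) <= rate R N + rate R N.
  move=> /subnKC<- /subnKC<-; apply: le_trans (cnorm_dist _ (u N) _) _.
  by rewrite [X in _ + X]cnormB lerD.
have [|y yP] := @cnorm_complete R A u.
  move=> e e0; have [N NP] := @rate_small R (e / 2) (divr_gt0 e0 (ltr0Sn _ _)).
  exists N => m p Nm Np; apply: le_lt_trans (ud _ _ _ Nm Np) _.
  by have := NP _ (leqnn N); lra.
exists y => // k; apply/ler_addgt0Pr => e /yP[N NP].
apply: le_trans (cnorm_dist _ (u (k + N)%N) _) _.
by rewrite cnormB lerD // ltW // NP // leq_addl.
Qed.

(** Self-adjointness of v and its commutation with the commutant of x are closed properties
    preserved by the iteration. *)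
Lemma cnorm_sqrt x : star x = x -> cnorm x <= 1 ->
  exists v, [/\ star v = v, (1 - v) * (1 - v) = 1 - x, cnorm v <= 1 &
    forall y, x * y = y * x -> v * y = y * v].
Proof.
move=> xs x1; pose bnd (y : A) (c : R) := cnorm y <= c.
have small (y : A) (C : R) : (forall k, cnorm y <= C * rate R k) -> y = 0.
  move=> H; apply: cnorm_eq0; apply: le_anti; rewrite cnorm_ge0 andbT.
  apply: (@le_small _ _ _ `|C|) => e /rate_small[N /(_ N (leqnn N)) Ne].
  rewrite add0r; apply: le_trans (H N) _; apply: le_trans (_ : `|C| * rate R N <= _).
    by rewrite ler_wpM2r ?rate_ge0 ?ler_norm.
  by rewrite ler_wpM2l // ltW.
have [||||||||v [vE v1 vP]] :=
    @sqrt_iteration R A ((2^-1 : R)%:C%:A) bnd half_alg _ _ _ _ _ _ _ _ x x1;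
  rewrite /bnd.
- by rewrite cnorm0.
- by move=> y c; rewrite cnormN.
- by move=> y c d _ cd /le_trans; apply.
- by move=> y z c d _ _ yc zd; apply: le_trans (cnormD _ _) _; exact: lerD.
- move=> y z c d c0 d0 yc zd; apply: le_trans (cnormM _ _) _.
  by apply: ler_pM => //; exact: cnorm_ge0.
- by rewrite cnorm_alg ger0_norm ?invr_ge0 ?ler0n.
- by move=> y; apply: (small y 2).
- move=> u uC.
  by have [y _ yP] := cauchy_rate uC; exists y.
exists v; split=> //.
  apply: (vP (fun a => star a = a)) => [|a aS|a aP]; first exact: star0.
    by rewrite starM star_alg starD starM aS xs -scalerAl -scalerAr mul1r mulr1.
  apply/eqP; rewrite -subr_eq0; apply/eqP/(small _ 2) => k.
  have [b bS] := aP k; rewrite /bnd => ba.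
  have -> : star a - a = - star (b - a) + (b - a).
    by rewrite starB bS opprB addrA subrK.
  apply: le_trans (cnormD _ _) _; rewrite cnormN cnorm_star; lra.
move=> y xy; apply: (vP (fun a => a * y = y * a)) => [|a aC|a aP]; first by rewrite mul0r mulr0.
  by rewrite -!scalerAl !mul1r -scalerAr mulrDl mulrDr xy -mulrA aC mulrA aC mulrA.
apply/eqP; rewrite -subr_eq0; apply/eqP/(small _ (2 * cnorm y)) => k.
have [b bC] := aP k; rewrite /bnd => ba.
have -> : a * y - y * a = y * (b - a) - (b - a) * y.
  by rewrite mulrBr mulrBl bC opprB [RHS]addrC addrA subrK.
apply: le_trans (cnorm_sub _ _) _.
have := cnormM y (b - a); have := cnormM (b - a) y.
by have := cnorm_ge0 y; nra.
Qed.

End CStarBasics.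

(** * Positive elements *)

Section Positivity.

Variables (R : realType) (A : cstarAlgType R).
Implicit Types (x y h : A) (r t : R).

(** The root is required to be self-adjoint because square roots are what the iteration yields; that
    every y^* y is positive is a theorem, [cpos_star_mul]. *)
Definition cpos h := exists2 w, star w = w & h = w * w.

Lemma cpos_sa h : cpos h -> star h = h.
Proof. by case=> w ws ->; rewrite starM ws. Qed.

Lemma cpos0 : cpos (0 : A).
Proof. by exists 0; rewrite ?star0 ?mulr0. Qed.

Lemma cposZ r h : 0 <= r -> cpos h -> cpos (r%:C *: h).
Proof.
move=> r0 [w ws ->]; exists ((Num.sqrt r)%:C *: w); first by rewrite starR ws.
by rewrite -scalerAl -scalerAr scalerA -rmorphM -[Num.sqrt _ * _]expr2 sqr_sqrtr.
Qed.

Lemma cpos_alg r : 0 <= r -> cpos (r%:C%:A : A).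
Proof. by move=> r0; apply: cposZ => //; exists 1; rewrite ?star1 ?mulr1. Qed.

Lemma sqrt_of_norm h t : star h = h -> 0 < t -> cnorm (t%:C%:A - h) <= t ->
  exists w, [/\ cpos w, w * w = h & forall y, h * y = y * h -> w * y = y * w].
Proof.
move=> hs t0 ht; pose x := 1 - t^-1%:C *: h.
have tn : t%:C != 0 by rewrite (inj_eq (@complexI _)) gt_eqF.
have hE : h = t%:C *: (1 - x).
  by rewrite /x opprB addrC subrK scalerA fmorphV divff // scale1r.
have xs : star x = x by rewrite starB star1 starR hs.
have x1 : cnorm x <= 1.
  rewrite -(ler_pM2l t0) mulr1; apply: le_trans ht.
  rewrite -{1}(gtr0_norm t0) -cnormR scalerBr scalerA fmorphV divff //.
  by rewrite scale1r.
have [v [vs vE v1 vC]] := cnorm_sqrt xs x1.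
(* A second root: 1 - v = (1 - v')^2, which makes the root of h itself positive. *)
have [v' [vs' vE' _ _]] := cnorm_sqrt vs v1.
exists ((Num.sqrt t)%:C *: (1 - v)); split.
- apply: cposZ; first exact: sqrtr_ge0.
  by exists (1 - v'); rewrite ?vE' // starB star1 vs'.
- rewrite -scalerAl -scalerAr scalerA -rmorphM -[Num.sqrt _ * _]expr2 sqr_sqrtr ?ltW //.
  by rewrite vE hE.
move=> y hy; rewrite -scalerAl -scalerAr mulrBl mulrBr mul1r mulr1 vC //.
by rewrite mulrBl mulrBr mul1r mulr1 -scalerAl -scalerAr hy.
Qed.

(** This stands in for the spectral argument that 0 <= h^2 <= 1 implies the same for 1 - h^2. *)
Lemma cnorm_one_sub_sqr h : star h = h -> cnorm h <= 1 -> cnorm (1 - h * h) <= 1.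
Proof.
move=> hs h1; have hhs : star (h * h) = h * h by rewrite starM hs.
have hh1 : cnorm (h * h) <= 1 by rewrite cnorm_sqr // expr_le1 ?cnorm_ge0.
have [v [vs vE _ vC]] := cnorm_sqrt hhs hh1.
have hv : v * h = h * v by apply: vC; rewrite mulrA.
pose w := 1 - v; have ws : star w = w by rewrite starB star1 vs.
have hw : w * h = h * w by rewrite /w mulrBl mulrBr hv mul1r mulr1.
(* u = h + i sqrt (1 - h^2) is unitary, and w = Im u. *)
pose u := h + 'i *: w.
have uE : star u = h - 'i *: w by rewrite starD starZ conjCi hs ws scaleNr.
have u1 : cnorm u ^+ 2 = 1.
  rewrite -cnorm_cstar -(cnorm1 A) uE /u mulrDr !mulrBl; congr cnorm.
  rewrite -!scalerAl -!scalerAr !scalerA hw -[_ * 'i]expr2 sqrCi scaleN1r opprK.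
  by rewrite addrA subrK [w * w]vE addrC subrK.
have {}u1 : cnorm u = 1.
  by apply/eqP; rewrite -(@eqrXn2 _ 2%N) ?cnorm_ge0 ?ler01 // u1 expr1n.
have w1 : cnorm w <= 1.
  have wE : (2^-1)%:C *: ((- 'i) *: (u - star u)) = w.
    have -> : u - star u = (2%:R * 'i) *: w.
      by rewrite uE /u opprB addrC addrA subrK -scalerA scaler_nat mulr2n.
    rewrite !scalerA [X in X *: w](_ : _ = 1) ?scale1r //.
    rewrite fmorphV rmorph_nat -?mulrA mulNr mulrN.
    by rewrite [_ * (2 * _)]mulrCA -expr2 sqrCi !mulrN1 mulrN opprK mulVf ?pnatr_eq0.
  rewrite -wE cnormR cnormZ cabs_unit ?normrN ?normCi // mul1r.
  rewrite ger0_norm ?invr_ge0 ?ler0n //.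
  by have := cnorm_sub u (star u); rewrite cnorm_star u1; lra.
by rewrite -vE cnorm_sqr // expr_le1 ?cnorm_ge0.
Qed.

(** With its converse [cpos_of_norm], this describes positivity by the convex closed condition ||t -
    h|| <= t, from which stability under sums and limits follows. *)
Lemma cpos_norm h t : cpos h -> cnorm h <= t -> cnorm (t%:C%:A - h) <= t.
Proof.
move=> [w ws hE] ht.
have t0 : 0 <= t by apply: le_trans ht; exact: cnorm_ge0.
have [tE|tn] := eqVneq t 0.
  move: ht; rewrite tE => h0.
  have /cnorm_eq0-> : cnorm h = 0 by apply/le_anti; rewrite h0 cnorm_ge0.
  by rewrite subr0 cnorm_alg normr0.
have tp : 0 < t by rewrite lt0r tn.
have sn : Num.sqrt t != 0 by rewrite gt_eqF // sqrtr_gt0.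
have sC : (Num.sqrt t)%:C != 0 by rewrite (inj_eq (@complexI _)).
pose g := (Num.sqrt t)^-1%:C *: w.
have gs : star g = g by rewrite starR ws.
have hg : h = t%:C *: (g * g).
  have e1 : t * ((Num.sqrt t)^-1 * (Num.sqrt t)^-1) = 1.
    by rewrite -{1}(sqr_sqrtr t0) expr2 mulrACA mulfV ?mulr1.
  by rewrite hE -scalerAl -scalerAr !scalerA -!rmorphM /= -mulrA e1 scale1r.
have g1 : cnorm g <= 1.
  rewrite -(@expr_le1 _ 2%N) ?cnorm_ge0 // -cnorm_sqr // -(ler_pM2l tp) mulr1.
  by apply: le_trans ht; rewrite hg cnormR gtr0_norm.
rewrite hg -scalerBr cnormR gtr0_norm // ger_pMr //.
exact: cnorm_one_sub_sqr.
Qed.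

Lemma cpos_of_norm h t : star h = h -> 0 <= t -> cnorm (t%:C%:A - h) <= t ->
  cpos h.
Proof.
move=> hs; rewrite le_eqVlt => /predU1P[<-|t0] ht.
  move: ht; rewrite scale0r sub0r cnormN => h0.
  suff -> : h = 0 by exact: cpos0.
  by apply/cnorm_eq0/le_anti; rewrite h0 cnorm_ge0.
have [w [[v vs wE] wh _]] := sqrt_of_norm hs t0 ht.
by exists w => //; rewrite wE starM vs.
Qed.

Lemma cpos_sqrt h : cpos h ->
  exists w, [/\ cpos w, w * w = h & forall y, h * y = y * h -> w * y = y * w].
Proof.
move=> hp; have h0 := cnorm_ge0 h; have hs := cpos_sa hp.
apply: (@sqrt_of_norm h (cnorm h + 1)) => //; first by rewrite ltr_wpDl.
by apply: cpos_norm => //; rewrite lerDl.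
Qed.

Lemma cposD h k : cpos h -> cpos k -> cpos (h + k).
Proof.
move=> hp kp; apply: (@cpos_of_norm _ (cnorm h + cnorm k)).
- by rewrite starD !cpos_sa.
- by rewrite addr_ge0 ?cnorm_ge0.
rewrite rmorphD /= scalerDl opprD addrACA; apply: le_trans (cnormD _ _) _.
by apply: lerD; apply: cpos_norm.
Qed.

Lemma cpos_sum (I : Type) (s : seq I) (P : pred I) (F : I -> A) :
  (forall i, P i -> cpos (F i)) -> cpos (\sum_(i <- s | P i) F i).
Proof. by move=> FP; apply: (big_ind cpos) => //; [exact: cpos0|exact: cposD]. Qed.

Lemma cnorm_sub_pos h : star h = h -> cpos ((cnorm h)%:C%:A - h).
Proof.
move=> hs; apply: (@cpos_of_norm _ (cnorm h)); rewrite ?cnorm_ge0 //.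
  by rewrite starB star_alg hs.
by rewrite opprB addrC subrK.
Qed.

Lemma cnorm_le_alg h t : 0 <= t -> cpos h -> cpos (t%:C%:A - h) -> cnorm h <= t.
Proof.
move=> t0 /cpos_sqrt[u [up uE uC]] /cpos_sqrt[w [wp wE wC]].
have us := cpos_sa up; have ws := cpos_sa wp.
have uh : u * h = h * u by apply: uC.
have wu : w * u = u * w.
  by apply: wC; rewrite mulrBl mulrBr -uh -scalerAl -scalerAr mul1r mulr1.
(* u^2 + w^2 = t, so that x = u + i w has norm sqrt t. *)
pose x := u + 'i *: w.
have xE : star x = u - 'i *: w by rewrite starD starZ conjCi us ws scaleNr.
have x1 : cnorm x ^+ 2 = t.
  rewrite -cnorm_cstar -[RHS](ger0_norm t0) -(cnorm_alg A) xE /x mulrDr !mulrBl.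
  congr cnorm.
  rewrite -!scalerAl -!scalerAr !scalerA wu -[_ * 'i]expr2 sqrCi scaleN1r opprK.
  by rewrite addrA subrK wE uE addrC subrK.
have ux : cnorm u <= cnorm x.
  have -> : u = (2^-1)%:C *: (x + star x).
    rewrite xE /x addrACA subrr addr0 -mulr2n.
    rewrite -scaler_nat scalerA fmorphV rmorph_nat.
    by rewrite mulVf ?pnatr_eq0 // scale1r.
  rewrite cnormR ger0_norm ?invr_ge0 ?ler0n //.
  by have := cnormD x (star x); rewrite cnorm_star; lra.
by rewrite -uE cnorm_sqr // -x1 lerXn2r ?nnegrE ?cnorm_ge0.
Qed.

Lemma cnorm_mono h k : cpos h -> cpos (k - h) -> cnorm h <= cnorm k.
Proof.
move=> hp khp; apply: cnorm_le_alg => //; first exact: cnorm_ge0.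
have kp : cpos k by rewrite -[k](subrK h); exact: cposD.
have -> : (cnorm k)%:C%:A - h = ((cnorm k)%:C%:A - k) + (k - h).
  by rewrite addrA subrK.
by apply: cposD => //; apply/cnorm_sub_pos/cpos_sa.
Qed.

Lemma cpos_antisym h : cpos h -> cpos (- h) -> h = 0.
Proof.
move=> hp hn; apply/cnorm_eq0/le_anti; rewrite cnorm_ge0 andbT.
by rewrite -(@cnorm0 _ A); apply: cnorm_mono => //; rewrite sub0r.
Qed.

End Positivity.

(** * Positivity of x^* x and closedness of the positive cone *)

Section StarSquares.

Variables (R : realType) (A : cstarAlgType R).
Implicit Types (x y z h : A) (r t : R).

(* With k = - z^* z, q = z z^* and t = ||z||^2, the identity (t + q) z = z (t - k)
   bounds the norm of (t + q) q (t + q) by t^3; but this element dominates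
   2 t q^2, whose norm is 2 t^3. *)
Lemma star_square_neg_eq0 z : cpos (- (star z * z)) -> cpos (z * star z) -> z = 0.
Proof.
set k := - _; set q := z * star z => kp qp.
have tq : cnorm q = cnorm z ^+ 2 by rewrite cnorm_star_mul.
have tk : cnorm k = cnorm z ^+ 2 by rewrite cnormN cnorm_cstar.
set t := cnorm z ^+ 2 in tq tk.
have t0 : 0 <= t by rewrite exprn_ge0 ?cnorm_ge0.
have qs := cpos_sa qp.
have tz : (t%:C%:A + q) * z = z * (t%:C%:A - k).
  by rewrite mulrDl mulrDr -scalerAl -scalerAr mul1r mulr1 opprK mulrA.
have le1 : cnorm ((t%:C%:A + q) * z) <= cnorm z * t.
  rewrite tz; apply: le_trans (cnormM _ _) _.
  by rewrite ler_wpM2l ?cnorm_ge0 // cpos_norm // tk.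
have eq2 : cnorm ((t%:C%:A + q) * z) ^+ 2 = cnorm ((t%:C%:A + q) * q * (t%:C%:A + q)).
  by rewrite -cnorm_star_mul starM starD star_alg qs !mulrA.
have {}le1 : cnorm ((t%:C%:A + q) * q * (t%:C%:A + q)) <= t * (t * t).
  rewrite -eq2 (le_trans (_ : _ <= (cnorm z * t) ^+ 2)) //.
    by rewrite lerXn2r ?nnegrE ?cnorm_ge0 // mulr_ge0 ?cnorm_ge0.
  by rewrite exprMn -/t expr2.
have le2 : 2 * t * t ^+ 2 <= t * (t * t).
  apply: le_trans le1; rewrite -{2}tq -cnorm_sqr //.
  have t2 : 0 <= 2 * t by rewrite mulr_ge0.
  rewrite -{1}(ger0_norm t2) -cnormR; apply: cnorm_mono.
    by apply: cposZ; [rewrite mulr_ge0|exists q].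
  have [g [gp gE gC]] := cpos_sqrt qp.
  have gq : g * q = q * g by apply: gC.
  have -> : (t%:C%:A + q) * q * (t%:C%:A + q) - (2 * t)%:C *: (q * q) =
      (t * t)%:C *: q + (g * q) * (g * q).
    have tq2 : (2 * t)%:C *: (q * q) = t%:C *: (q * q) + t%:C *: (q * q).
      by rewrite rmorphM rmorph_nat -scalerA scaler_nat mulr2n.
    rewrite tq2 mulrDl mulrDr !mulrDl -!scalerAl -!scalerAr !mul1r !mulr1.
    rewrite scalerA -rmorphM [_ *: (q * q) + q * q * q]addrC addrACA addrK.
    by congr (_ + _); rewrite {1}gq -[q * g * _]mulrA [g * (g * q)]mulrA gE mulrA.
  apply: cposD; first by apply: (cposZ _ qp); exact: mulr_ge0.
  by exists (g * q) => //; rewrite starM (cpos_sa gp) qs gq.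
have t_eq0 : t = 0.
  apply/eqP; rewrite eq_le t0 andbT leNgt; apply/negP => tp.
  have := mulr_gt0 tp (mulr_gt0 tp tp); move: le2; rewrite expr2; lra.
by apply: cnorm_eq0; apply/eqP; rewrite -sqrf_eq0 -/t t_eq0.
Qed.

Lemma cpos_star_mul y : cpos (star y * y).
Proof.
set h := star y * y; have hs : star h = h by rewrite starM starK.
have hhp : cpos (h * h) by exists h.
have [m [mp mE mC]] := cpos_sqrt hhp.
have ms := cpos_sa mp.
have mh : m * h = h * m by apply: mC; rewrite mulrA.
have [u [up uE uC]] := cpos_sqrt mp.
have us := cpos_sa up.
(* k is twice the negative part of h; it vanishes because z = y k satisfies
   z^* z <= 0 and z z^* >= 0. *)
pose k := m - h; have ks : star k = k by rewrite starB ms hs.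
have mk : m * k = k * m by rewrite mulrBr mulrBl mh.
have uk : u * k = k * u by apply: uC.
have hk : h * k = - (m * k).
  by rewrite /k !mulrBr mE mh opprB.
have kk : k * k = 2%:R *: (m * k).
  by rewrite {1}/k mulrBl hk opprK scaler_nat mulr2n.
pose z := y * k.
have zzE : star z * z = - (u * k * (u * k)).
  rewrite /z starM ks !mulrA -[k * star y * y]mulrA -/h -mulrA hk mulrN.
  by rewrite -uE -!mulrA uk !mulrA uk.
have kp : cpos (u * k * (u * k)).
  by exists (u * k) => //; rewrite starM us ks uk.
have z0 : z = 0.
  apply: star_square_neg_eq0; rewrite ?zzE ?opprK //.
  (* The squares of z + z^* and i (z - z^* ) add up to 2 (z z^* + z^* z), and - z^* z is the square
     of u k. *)
  have -> : z * star z = 2^-1%:C *: ((z + star z) * (z + star z) +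
      ('i *: (z - star z)) * ('i *: (z - star z))) + u * k * (u * k).
    apply/eqP; rewrite -subr_eq -[- (u * _ * _)]zzE; apply/eqP.
    rewrite -scalerAl -scalerAr scalerA -['i * 'i]expr2 sqrCi scaleN1r.
    rewrite mulrDl mulrBl ![_ * (z - star z)]mulrBr ![_ * (z + star z)]mulrDr opprB.
    rewrite [star z * z - _ + _]addrC addrACA.
    rewrite opprB [z * z + _]addrC [_ + (z * star z - _)]addrACA subrr addr0.
    rewrite [star z * z + _ + _]addrACA subrr addr0.
    rewrite -!mulr2n -mulrnDl -scaler_nat scalerA fmorphV rmorph_nat.
    by rewrite mulVf ?pnatr_eq0 // scale1r.
  apply: cposD => //; apply: cposZ; first by rewrite invr_ge0 ler0n.
  apply: cposD; first by exists (z + star z); rewrite // starD starK addrC.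
  exists ('i *: (z - star z)) => //.
  by rewrite starZ conjCi starB starK scaleNr -scalerN opprB.
have mk0 : k * (m * k) = 0.
  have : star z * z = 0 by rewrite z0 mulr0.
  rewrite zzE => /eqP; rewrite oppr_eq0 => /eqP <-.
  by rewrite -uE !mulrA -uk -!mulrA uk.
have k0 : k = 0.
  have k4 : k * k * (k * k) = 0.
    by rewrite {2}kk -scalerAr -mulrA mk0 mulr0 scaler0.
  have kks : star (k * k) = k * k by rewrite starM ks.
  apply: cnorm_eq0; apply/eqP; rewrite -sqrf_eq0 -cnorm_sqr // -sqrf_eq0.
  by rewrite -cnorm_sqr // k4 cnorm0.
by have /eqP := k0; rewrite subr_eq0 => /eqP <-.
Qed.

Lemma cpos_conj h x : cpos h -> cpos (star x * h * x).
Proof.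
case=> w ws ->; have -> : star x * (w * w) * x = star (w * x) * (w * x).
  by rewrite starM ws !mulrA.
exact: cpos_star_mul.
Qed.

Lemma cpos_lim h : (forall e : R, 0 < e -> exists2 k, cpos k & cnorm (h - k) < e) ->
  cpos h.
Proof.
move=> H.
have hs : star h = h.
  apply/eqP; rewrite -subr_eq0; apply/eqP/cnorm_eq0/le_anti; rewrite cnorm_ge0 andbT.
  apply/ler_addgt0Pr => e e0; rewrite add0r.
  have [k kp hk] := H (e / 2) (divr_gt0 e0 (ltr0Sn _ _)).
  have -> : star h - h = star (h - k) - (h - k).
    by rewrite starB (cpos_sa kp) opprB addrA subrK.
  by have := cnorm_sub (star (h - k)) (h - k); rewrite cnorm_star; lra.
(* One t must serve for all approximants: ||h|| + 1 exceeds the norm of each k within 1 of h. *)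
have t0 : 0 <= cnorm h + 1 by rewrite addr_ge0 ?cnorm_ge0.
apply: (cpos_of_norm hs t0); apply/ler_addgt0Pr => e e0.
have e1 : 0 < Num.min e 1 by rewrite lt_min e0 ltr01.
have [k kp] := H _ e1; rewrite lt_min => /andP[ke k1].
apply: le_trans (cnorm_dist _ k _) _.
apply: lerD; first apply: cpos_norm => //.
  have := cnormD h (k - h); rewrite (addrC h (k - h)) subrK (cnormB k h); lra.
by rewrite cnormB ltW.
Qed.

Lemma cpos_norm_bound x y :
  cpos ((cnorm x ^+ 2)%:C *: (star y * y) - star y * (star x * x) * y).
Proof.
rewrite -cnorm_cstar -[star y in X in _ *: X]mulr1 scalerAl scalerAr -mulrBl -mulrBr.
by apply/cpos_conj/cnorm_sub_pos; rewrite starM starK.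
Qed.

End StarSquares.

(** * Norm limits of sequences *)

Section Convergence.

Variables (R : realType) (A : cstarAlgType R).
Implicit Types (u v : nat -> A) (x y : A).

Lemma ccvg_cst x : ccvg (fun _ => x) x.
Proof. by move=> e e0; exists 0%N => m _; rewrite subrr cnorm0. Qed.

Lemma ccvgD u v x y : ccvg u x -> ccvg v y -> ccvg (fun k => u k + v k) (x + y).
Proof.
move=> ux vy e e0; have e2 : 0 < e / 2 by rewrite divr_gt0.
have [N NP] := ux _ e2; have [M MP] := vy _ e2.
exists (maxn N M) => m; rewrite geq_max => /andP[/NP h1 /MP h2].
by rewrite opprD addrACA; apply: le_lt_trans (cnormD _ _) _; lra.
Qed.

Lemma ccvg_bounded (f : A -> A) (C : R) u x :
  (forall a b, cnorm (f a - f b) <= C * cnorm (a - b)) ->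
  ccvg u x -> ccvg (fun k => f (u k)) (f x).
Proof.
move=> fC ux e e0; have C1 : 0 < `|C| + 1 by rewrite ltr_wpDl.
have [N NP] := ux _ (divr_gt0 e0 C1); exists N => m /NP.
rewrite ltr_pdivlMr // => h; apply: le_lt_trans (fC _ _) _.
apply: le_lt_trans h; rewrite mulrC ler_wpM2l ?cnorm_ge0 //.
by rewrite (le_trans (ler_norm C)) // lerDl.
Qed.

Lemma ccvg_star u x : ccvg u x -> ccvg (fun k => star (u k)) (star x).
Proof.
by apply: (@ccvg_bounded _ 1) => a b; rewrite -starB cnorm_star mul1r.
Qed.

Lemma ccvgMl a u x : ccvg u x -> ccvg (fun k => a * u k) (a * x).
Proof.
by apply: (@ccvg_bounded (fun b => a * b) (cnorm a)) => b c; rewrite -mulrBr cnormM.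
Qed.

Lemma ccvgMr a u x : ccvg u x -> ccvg (fun k => u k * a) (x * a).
Proof.
by apply: (@ccvg_bounded (fun b => b * a) (cnorm a)) => b c;
  rewrite -mulrBl mulrC cnormM.
Qed.

Lemma ccvgN u x : ccvg u x -> ccvg (fun k => - u k) (- x).
Proof.
by apply: (@ccvg_bounded _ 1) => a b; rewrite -opprD cnormN mul1r.
Qed.

Lemma ccvgB u v x y : ccvg u x -> ccvg v y -> ccvg (fun k => u k - v k) (x - y).
Proof. by move=> ux vy; apply: ccvgD => //; exact: ccvgN. Qed.

Lemma ccvgZ (c : R[i]) u x : ccvg u x -> ccvg (fun k => c *: u k) (c *: x).
Proof.
by apply: (@ccvg_bounded (fun b => c *: b) (cabs c)) => a b; rewrite -scalerBr cnormZ.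
Qed.

Lemma ccvgM u v x y : ccvg u x -> ccvg v y -> ccvg (fun k => u k * v k) (x * y).
Proof.
move=> ux vy e e0; pose C := (cnorm x + 1) + cnorm y.
have C0 : 0 < C by rewrite /C; have := cnorm_ge0 x; have := cnorm_ge0 y; lra.
have e1 : 0 < Num.min (e / C) 1 by rewrite lt_min divr_gt0 ?ltr01.
have [N NP] := ux _ e1; have [M MP] := vy _ e1.
exists (maxn N M) => m; rewrite geq_max => /andP[/NP + /MP].
rewrite !lt_min => /andP[h1 h2] /andP[h3 _].
have hu : cnorm (u m) <= cnorm x + 1.
  by have := cnormD x (u m - x); rewrite [x + _]addrC subrK; lra.
have -> : u m * v m - x * y = u m * (v m - y) + (u m - x) * y.
  by rewrite mulrBr mulrBl addrA subrK.
apply: le_lt_trans (cnormD _ _) _.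
apply: le_lt_trans (lerD (cnormM _ _) (cnormM _ _)) _.
have eC : e = (cnorm x + 1) * (e / C) + (e / C) * cnorm y.
  by rewrite [X in X + _]mulrC -mulrDr -/C divfK // gt_eqF.
rewrite [ltRHS]eC; apply: ltr_leD.
  apply: le_lt_trans (_ : (cnorm x + 1) * cnorm (v m - y) < _).
    by rewrite ler_wpM2r ?cnorm_ge0.
  by rewrite ltr_pM2l // ltr_wpDl ?cnorm_ge0.
by rewrite ler_wpM2r ?cnorm_ge0 // ltW.
Qed.

Lemma ccvg_star_mul u x : ccvg u x -> ccvg (fun k => star (u k) * u k) (star x * x).
Proof. by move=> ux; apply: ccvgM => //; exact: ccvg_star. Qed.

Lemma ccvg_prod (I : Type) (s : seq I) (F : I -> nat -> A) :
  (forall i, ccvg (F i) 1) -> ccvg (fun k => \prod_(i <- s) F i k) 1.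
Proof.
move=> F1; elim: s => [|i s IH].
  by move=> e e0; exists 0%N => m _; rewrite big_nil subrr cnorm0.
have := ccvgM (F1 i) IH; rewrite mulr1 => H e /H[N NP]; exists N => m /NP.
by rewrite big_cons.
Qed.

Lemma ccvg_sum (I : Type) (s : seq I) (P : pred I) (F : I -> nat -> A) (G : I -> A) :
  (forall i, P i -> ccvg (F i) (G i)) ->
  ccvg (fun k => \sum_(i <- s | P i) F i k) (\sum_(i <- s | P i) G i).
Proof.
move=> FG; elim: s => [|i s IH].
  by move=> e e0; exists 0%N => m _; rewrite !big_nil subrr cnorm0.
have [Pi|nPi] := boolP (P i); last first.
  move=> e /IH[N NP]; exists N => m /NP; rewrite !big_cons (negPf nPi); exact.
have := ccvgD (FG i Pi) IH; move=> H e /H[N NP]; exists N => m /NP.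
by rewrite !big_cons Pi.
Qed.

Lemma ccvg_cpos u x : (forall k, cpos (u k)) -> ccvg u x -> cpos x.
Proof.
move=> up ux; apply: cpos_lim => e /ux[N NP].
by exists (u N) => //; rewrite cnormB NP.
Qed.

Lemma ccvg_cnorm_le u x (c : R) : (forall k, cnorm (u k) <= c) -> ccvg u x ->
  cnorm x <= c.
Proof.
move=> uc ux; apply/ler_addgt0Pr => e /ux[N NP].
have := cnorm_dist x (u N) 0; rewrite !subr0 cnormB.
by have := NP _ (leqnn N); have := uc N; lra.
Qed.

End Convergence.

(** * Matrices over a C*-algebra *)

Section MatrixBounds.

Variables (R : realType) (A : cstarAlgType R).
Implicit Types (p q m : nat).

Local Notation adj := (mx_star (@star R A)).
(** Matrices over A are scaled by elements of A, so real scalars are passed as multiples of 1. *)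
Local Notation re r := (r%:C%:A : A).

Definition dot m (u v : 'cV[A]_m) : A := \sum_i star (u i 0) * v i 0.

Lemma dotDl m (u v w : 'cV[A]_m) : dot (u + v) w = dot u w + dot v w.
Proof. by rewrite -big_split; apply: eq_bigr => i _; rewrite mxE starD mulrDl. Qed.

Lemma dotDr m (u v w : 'cV[A]_m) : dot w (u + v) = dot w u + dot w v.
Proof. by rewrite -big_split; apply: eq_bigr => i _; rewrite mxE mulrDr. Qed.

Lemma dotZl m r (u v : 'cV[A]_m) : dot (re r *: u) v = r%:C *: dot u v.
Proof.
rewrite scaler_sumr; apply: eq_bigr => i _.
by rewrite mxE starM star_alg -scalerAr mulr1 -scalerAl.
Qed.

Lemma dotZr m r (u v : 'cV[A]_m) : dot u (re r *: v) = r%:C *: dot u v.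
Proof.
rewrite scaler_sumr; apply: eq_bigr => i _.
by rewrite mxE -scalerAl mul1r -scalerAr.
Qed.

Lemma dotNl m (u v : 'cV[A]_m) : dot (- u) v = - dot u v.
Proof. by rewrite -sumrN; apply: eq_bigr => i _; rewrite mxE starN mulNr. Qed.

Lemma dotNr m (u v : 'cV[A]_m) : dot u (- v) = - dot u v.
Proof. by rewrite -sumrN; apply: eq_bigr => i _; rewrite mxE mulrN. Qed.

Lemma dotBB m (u v : 'cV[A]_m) :
  dot (u - v) (u - v) = dot u u + dot v v - (dot u v + dot v u).
Proof.
rewrite dotDl !dotDr !(dotNl, dotNr) opprK [- dot v u + _]addrC addrACA.
by rewrite -opprD.
Qed.

Lemma dot_mulmx p m (X : 'M[A]_(p, m)) (u : 'cV_p) (v : 'cV_m) :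
  dot u (X *m v) = dot (adj X *m u) v.
Proof.
rewrite /dot; under eq_bigr do rewrite mxE mulr_sumr.
rewrite exchange_big; apply: eq_bigr => j _.
rewrite mxE star_sum mulr_suml; apply: eq_bigr => i _.
by rewrite !mxE starM starK mulrA.
Qed.

Lemma adjK p m (X : 'M[A]_(p, m)) : adj (adj X) = X.
Proof. by apply/matrixP => i j; rewrite !mxE starK. Qed.

Lemma adjM p m q (X : 'M[A]_(p, m)) (Y : 'M[A]_(m, q)) :
  adj (X *m Y) = adj Y *m adj X.
Proof.
apply/matrixP => i j; rewrite !mxE star_sum.
by apply: eq_bigr => k _; rewrite !mxE starM.
Qed.

Lemma adjD p m (X Y : 'M[A]_(p, m)) : adj (X + Y) = adj X + adj Y.
Proof. by apply/matrixP => i j; rewrite !mxE starD. Qed.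

Lemma adj0 p m : adj (0 : 'M[A]_(p, m)) = 0.
Proof. by apply/matrixP => i j; rewrite !mxE star0. Qed.

Lemma adj1 m : adj (1%:M : 'M[A]_m) = 1%:M.
Proof.
by apply/matrixP => i j; rewrite !mxE eq_sym; case: eqP; rewrite ?star1 ?star0.
Qed.

Lemma adjN p m (X : 'M[A]_(p, m)) : adj (- X) = - adj X.
Proof. by apply/matrixP => i j; rewrite !mxE starN. Qed.

Lemma adjZ p m r (X : 'M[A]_(p, m)) : adj (re r *: X) = re r *: adj X.
Proof.
by apply/matrixP => i j; rewrite !mxE starM star_alg -scalerAr -scalerAl mul1r mulr1.
Qed.

Lemma mulmx_rscale p m q r (X : 'M[A]_(p, m)) (Y : 'M[A]_(m, q)) :
  X *m (re r *: Y) = re r *: (X *m Y).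
Proof.
apply/matrixP => i j; rewrite !mxE mulr_sumr; apply: eq_bigr => k _.
by rewrite mxE -!scalerAl !mul1r -scalerAr.
Qed.

Lemma cpos_dot m (v : 'cV[A]_m) : cpos (dot v v).
Proof. by apply: cpos_sum => i _; exact: cpos_star_mul. Qed.

Lemma dot_entry m (v : 'cV[A]_m) i : cpos (dot v v - star (v i 0) * v i 0).
Proof.
rewrite /dot (bigD1 i) //= addrAC subrr add0r.
by apply: cpos_sum => j _; exact: cpos_star_mul.
Qed.

Lemma dot_eq0 m (v : 'cV[A]_m) : dot v v = 0 -> v = 0.
Proof.
move=> v0; apply/colP => i; rewrite mxE; apply: cnorm_eq0.
have h : cnorm (v i 0) ^+ 2 <= 0.
  rewrite -cnorm_cstar -(@cnorm0 _ A) -v0.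
  by apply: cnorm_mono; [exact: cpos_star_mul|exact: dot_entry].
by apply/eqP; rewrite -sqrf_eq0 eq_le h sqr_ge0.
Qed.

(** The bound |X v|^2 <= c^2 |v|^2 for X acting on the Hilbert module A^m, in the order of A. Upper
    bounds suffice for the iteration, so no norm on matrices is constructed. *)
Definition mbnd p m (X : 'M[A]_(p, m)) (c : R) := forall v : 'cV[A]_m,
  cpos ((c ^+ 2)%:C *: dot v v - dot (X *m v) (X *m v)).

Lemma mbnd0 p m : mbnd (0 : 'M[A]_(p, m)) 0.
Proof.
move=> v; rewrite mul0mx expr0n scale0r sub0r /dot big1 ?oppr0; first exact: cpos0.
by move=> i _; rewrite mxE mulr0.
Qed.

Lemma mbndN p m (X : 'M[A]_(p, m)) c : mbnd X c -> mbnd (- X) c.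
Proof. by move=> Xc v; rewrite mulNmx dotNl dotNr opprK. Qed.

Lemma mbnd_le p m (X : 'M[A]_(p, m)) c d : 0 <= c -> c <= d -> mbnd X c -> mbnd X d.
Proof.
move=> c0 cd Xc v; rewrite -[d ^+ 2](subrK (c ^+ 2)) rmorphD scalerDl -addrA.
apply: cposD (Xc v); apply: cposZ (cpos_dot v).
by rewrite subr_ge0 lerXn2r ?nnegrE // (le_trans c0).
Qed.

Lemma mbndM p m q (X : 'M[A]_(p, m)) (Y : 'M[A]_(m, q)) c d :
  mbnd X c -> mbnd Y d -> mbnd (X *m Y) (c * d).
Proof.
move=> Xc Yd v; rewrite -mulmxA exprMn rmorphM -scalerA.
have -> : (c ^+ 2)%:C *: ((d ^+ 2)%:C *: dot v v) =
    (c ^+ 2)%:C *: ((d ^+ 2)%:C *: dot v v - dot (Y *m v) (Y *m v)) +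
    (c ^+ 2)%:C *: dot (Y *m v) (Y *m v).
  by rewrite -scalerDr subrK.
by rewrite -addrA; apply: cposD (Xc _); apply: cposZ (Yd v); rewrite sqr_ge0.
Qed.

Lemma mbnd_eq0 p m (X : 'M[A]_(p, m)) : mbnd X 0 -> forall v : 'cV_m, X *m v = 0.
Proof.
move=> X0 v; apply: dot_eq0; apply: cpos_antisym (cpos_dot _) _.
by have := X0 v; rewrite expr0n scale0r sub0r.
Qed.

Lemma mbndD p m (X Y : 'M[A]_(p, m)) c d : 0 <= c -> 0 <= d ->
  mbnd X c -> mbnd Y d -> mbnd (X + Y) (c + d).
Proof.
(* The identity used below divides by c and d; a matrix with bound 0 acts as 0. *)
rewrite le_eqVlt => /predU1P[<- _|c0].
  by move=> /mbnd_eq0 X0 Yd v; rewrite add0r mulmxDl X0 add0r.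
rewrite le_eqVlt => /predU1P[<- Xc|d0 Xc Yd v].
  by move=> /mbnd_eq0 Y0 v; rewrite addr0 mulmxDl Y0 addr0.
(* (c + d)^2 |v|^2 - |u + w|^2 = (1 + d/c) (c^2 |v|^2 - |u|^2)
     + (1 + c/d) (d^2 |v|^2 - |w|^2) + |d u - c w|^2 / (c d). *)
rewrite mulmxDl; set u := X *m v; set w := Y *m v.
pose s := d / c; pose t := c / d.
have cN := lt0r_neq0 c0; have dN := lt0r_neq0 d0.
have -> : (c + d) ^+ 2 = (1 + s) * c ^+ 2 + (1 + t) * d ^+ 2.
  by rewrite /s /t; field; rewrite cN dN.
have T : cpos ((s%:C *: dot u u + t%:C *: dot w w) - (dot u w + dot w u)).
  have -> : (s%:C *: dot u u + t%:C *: dot w w) - (dot u w + dot w u) =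
      (c * d)^-1%:C *: dot (re d *: u - re c *: w) (re d *: u - re c *: w).
    rewrite dotBB !(dotZl, dotZr) scalerBr !scalerDr !scalerA -!rmorphM /=.
    rewrite [d * c]mulrC mulVf ?mulf_neq0 // !scale1r.
    by congr (_%:C *: _ + _%:C *: _ - _); rewrite /s /t; field; rewrite cN dN.
  by apply: cposZ (cpos_dot _); rewrite invr_ge0 mulr_ge0 ?ltW.
have s0 : 0 <= 1 + s by rewrite addr_ge0 ?divr_ge0 ?ltW.
have t0 : 0 <= 1 + t by rewrite addr_ge0 ?divr_ge0 ?ltW.
have := cposD (cposD (cposZ s0 (Xc v)) (cposZ t0 (Yd v))) T.
congr cpos; rewrite -/u -/w.
have E (e f : R) (a b : A) : (1 + e)%:C *: (f%:C *: a - b) =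
    ((1 + e) * f)%:C *: a - (b + e%:C *: b).
  by rewrite scalerBr scalerA -rmorphM [in X in _ - X = _]rmorphD scalerDl scale1r.
rewrite !E rmorphD scalerDl dotDl !dotDr [X in X + _ = _]addrACA -[LHS]addrA; congr (_ + _).
rewrite -opprD [dot u u + s%:C *: _ + _]addrACA opprD -addrA addKr -opprD.
by rewrite [dot w u + _]addrC addrACA.
Qed.

Lemma mbnd_entry p m (X : 'M[A]_(p, m)) c i j : 0 <= c -> mbnd X c ->
  cnorm (X i j) <= c.
Proof.
move=> c0 /(_ (delta_mx j 0)); rewrite -colE => Xc.
rewrite -(@ler_pXn2r _ 2) ?nnegrE ?cnorm_ge0 // -cnorm_cstar.
have d1 : dot (delta_mx j 0 : 'cV[A]_m) (delta_mx j 0) = 1.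
  rewrite /dot (bigD1 j) //= big1 ?addr0 => [|k kj]; rewrite !mxE ?eqxx ?star1 ?mulr1 //.
  by rewrite (negPf kj) mulr0.
rewrite d1 in Xc.
have := dot_entry (col j X) i; rewrite mxE => Xe.
apply: cnorm_le_alg; [exact: sqr_ge0|exact: cpos_star_mul|].
by have := cposD Xc Xe; rewrite addrA subrK.
Qed.

Lemma mbnd_delta p m (x : A) i j : mbnd (x *: delta_mx i j : 'M[A]_(p, m)) (cnorm x).
Proof.
move=> v; have -> : dot (x *: delta_mx i j *m v) (x *: delta_mx i j *m v) =
    star (v j 0) * (star x * x) * v j 0 :> A.
  rewrite -scalemxAl /dot (bigD1 i) //= big1 ?addr0 => [|k ki].
    rewrite !mxE (bigD1 j) //= big1 ?addr0 => [|k kj].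
      by rewrite !mxE !eqxx mul1r starM !mulrA.
    by rewrite mxE (negPf kj) andbF mul0r.
  rewrite !mxE big1 ?mulr0 // => l _.
  by rewrite mxE (negPf ki) mul0r.
have := cposD (cposZ (sqr_ge0 (cnorm x)) (dot_entry v j)) (cpos_norm_bound x (v j 0)).
by rewrite scalerBr addrA subrK.
Qed.

Lemma mbnd_exists p m (X : 'M[A]_(p, m)) : exists2 c, 0 <= c & mbnd X c.
Proof.
rewrite [X]matrix_sum_delta.
have P0 : exists2 c, 0 <= c & mbnd (0 : 'M[A]_(p, m)) c by exists 0; [|exact: mbnd0].
have PD (Y Z : 'M[A]_(p, m)) : (exists2 c, 0 <= c & mbnd Y c) ->
    (exists2 c, 0 <= c & mbnd Z c) -> exists2 c, 0 <= c & mbnd (Y + Z) c.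
  by move=> [c c0 Yc] [d d0 Zd]; exists (c + d); [exact: addr_ge0|exact: mbndD].
apply: (big_ind (fun Y => exists2 c, 0 <= c & mbnd Y c)) => // i _.
apply: (big_ind (fun Y => exists2 c, 0 <= c & mbnd Y c)) => // j _.
by exists (cnorm (X i j)); [exact: cnorm_ge0|exact: mbnd_delta].
Qed.

(** An operator bound controls the entries, which yields the limit; the bound passes to the limit
    because positivity is closed. *)
Lemma mbnd_complete m (u : nat -> 'M[A]_m) :
  (forall k p, mbnd (u (k + p)%N - u k) (rate R k)) ->
  exists2 X : 'M[A]_m, forall i j, ccvg (fun k => u k i j) (X i j) &
    forall k, mbnd (u k - X) (rate R k).
Proof.
move=> uC.
have ent i j k p : cnorm (u (k + p)%N i j - u k i j) <= rate R k.
  by have := mbnd_entry i j (rate_ge0 R k) (uC k p); rewrite !mxE.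
have lims i j : exists x, ccvg (fun k => u k i j) x.
  by have [x xl _] := cauchy_rate (ent i j); exists x.
have [X XP] : exists X : 'M[A]_m, forall i j, ccvg (fun k => u k i j) (X i j).
  have [X XP] := fin_all_exists (fun i => fin_all_exists (lims i)).
  by exists (\matrix_(i, j) X i j) => i j; rewrite mxE.
exists X => // k v; rewrite -[u k - X]opprB mulNmx dotNl dotNr opprK.
apply: (@ccvg_cpos _ _ (fun p => (rate R k ^+ 2)%:C *: dot v v -
  dot ((u (k + p)%N - u k) *m v) ((u (k + p)%N - u k) *m v))) => [p|].
  exact: uC.
apply: ccvgB; first exact: ccvg_cst.
apply: ccvg_sum => i _; apply: ccvg_star_mul.
have H : ccvg (fun p => \sum_j (u (k + p)%N i j - u k i j) * v j 0)
    (\sum_j (X i j - u k i j) * v j 0).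
  apply: ccvg_sum => j _; apply: ccvgMr; apply: ccvgB (ccvg_cst _).
  by move=> e /(XP i j)[N NP]; exists N => p Np; apply: NP; rewrite (leq_trans Np) ?leq_addl.
have E (Y : 'M[A]_m) : ((Y - u k) *m v) i 0 = \sum_j (Y i j - u k i j) * v j 0.
  by rewrite mxE; apply: eq_bigr => j _; rewrite !mxE.
by move=> e /H[N NP]; exists N => p /NP; rewrite !E.
Qed.

(* [mx_positive] asks for a square factor, whereas Gram matrices come with
   rectangular ones. *)
Lemma mx_square_root m (Z : 'M[A]_m) (r : nat) (Y : 'M[A]_(r, m)) : Z = adj Y *m Y ->
  exists W : 'M[A]_m, Z = adj W *m W.
Proof.
move=> ZE; have Zs : adj Z = Z by rewrite ZE adjM adjK.
have [c0 c00 Yc0] := mbnd_exists (adj Y).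
pose c := c0 + 1; have c_gt0 : 0 < c by rewrite ltr_wpDl.
have Yc : mbnd (adj Y) c by apply: mbnd_le Yc0; rewrite // lerDl.
pose t := c ^+ 2; have t0 : 0 < t by rewrite exprn_gt0.
pose x := 1 - re t^-1 *: Z.
have xs : adj x = x by rewrite adjD adjN adjZ Zs adj1.
(* |v|^2 - |x v|^2 = t^-2 ((t |Y v|^2 - |Y^* Y v|^2) + t |Y v|^2), where the first difference is
   positive because t = c^2 and c bounds Y^*. *)
have bx : mbnd x 1.
  move=> v; rewrite expr1n scale1r.
  have -> : x *m v = v - re t^-1 *: (Z *m v) by rewrite mulmxBl mul1mx scalemxAl.
  rewrite dotBB !(dotZl, dotZr).
  have -> : dot (Z *m v) v = dot (Y *m v) (Y *m v).
    by rewrite dot_mulmx mulmxA -ZE.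
  have -> : dot v (Z *m v) = dot (Y *m v) (Y *m v).
    by rewrite dot_mulmx Zs dot_mulmx mulmxA -ZE.
  have -> : dot (Z *m v) (Z *m v) = dot (adj Y *m (Y *m v)) (adj Y *m (Y *m v)).
    by rewrite mulmxA -ZE.
  have h1 := Yc (Y *m v); have h2 := cposZ (ltW t0) (cpos_dot (Y *m v)).
  have ti : 0 <= t^-1 by rewrite invr_ge0 ltW.
  have := cposZ ti (cposZ ti (cposD h1 h2)); congr cpos.
  have E (y : A) : t^-1%:C *: (t%:C *: y) = y.
    by rewrite scalerA -rmorphM mulVf ?gt_eqF // scale1r.
  rewrite -/t [X in _ *: (_ *: X)]addrAC -scalerDr scalerBr E scalerBr scalerDr.
  by rewrite opprB [RHS]addrCA [- (dot v v + _)]opprD [dot v v + _]addrA subrr add0r.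
pose hlf : 'M[A]_m := (re 2^-1)%:M.
have hlfE p (X : 'M[A]_(m, p)) : hlf *m X = re 2^-1 *: X by rewrite mul_scalar_mx.
have [|||||||||w [wE _ wP]] := @sqrt_iteration R 'M[A]_m hlf (@mbnd m m) _ _ _ _ _ _ _ _ _ x bx.
- by rewrite -raddfD /= half_alg.
- exact: mbnd0.
- by move=> X d; exact: mbndN.
- by move=> X d e; exact: mbnd_le.
- by move=> X X' d e; exact: mbndD.
- by move=> X X' d e _ _; exact: mbndM.
- move=> v; rewrite hlfE dotZl dotZr scalerA -rmorphM expr2 subrr; exact: cpos0.
- move=> X X0; apply/matrixP => i j; rewrite mxE; apply: cnorm_eq0.
  apply: le_anti; rewrite cnorm_ge0 andbT.
  apply: (@le_small _ _ _ 2) => e /rate_small[N /(_ N (leqnn N)) Ne].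
  have r0 : 0 <= 2 * rate R N by rewrite mulr_ge0 ?rate_ge0.
  by have := mbnd_entry i j r0 (X0 N); lra.
- by move=> u /mbnd_complete[X _ XP]; exists X.
have ws : adj w = w.
  apply: (wP (fun a => adj a = a)) => [|a aS|a aP]; first exact: adj0.
    by rewrite -mulmxE !hlfE adjZ adjD adjM aS xs.
  apply/matrixP => i j; rewrite !mxE; apply/eqP; rewrite -subr_eq0; apply/eqP.
  apply/cnorm_eq0/le_anti; rewrite cnorm_ge0 andbT.
  apply: (@le_small _ _ _ 2) => e /rate_small[N /(_ N (leqnn N)) Ne].
  have [b bS ba] := aP N.
  have h1 := mbnd_entry i j (rate_ge0 R N) ba.
  have h2 := mbnd_entry j i (rate_ge0 R N) ba; rewrite !mxE in h1 h2.
  have -> : star (a j i) - a i j = - star (b j i - a j i) + (b i j - a i j).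
    by rewrite starB -{2}bS !mxE opprB addrA subrK.
  by have := cnormD (- star (b j i - a j i)) (b i j - a i j); rewrite cnormN cnorm_star; lra.
exists (re (Num.sqrt t) *: (1 - w)).
rewrite adjZ adjD adjN adj1 ws mulmx_rscale -scalemxAl mulmxE wE /x opprB addrC subrK.
have reM (a b : R) : re a * re b = re (a * b).
  by rewrite -scalerAl mul1r scalerA -rmorphM.
rewrite !scalerA !reM -mulrA -?expr2 mulrA -expr2 sqr_sqrtr ?ltW //.
by rewrite mulfV ?gt_eqF // !scale1r.
Qed.

End MatrixBounds.

(** * Completely positive factorizations *)

Section ComplexMatrices.

Variable R : realType.

Local Notation conj := (fun c : R[i] => Num.conj c).

(** Diagonalize M as P^* D P with P unitary. The form at the conjugated rows of P shows that D >= 0,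
    and Z = sqrt(D) P. *)
Lemma psd_factor k (M : 'M[R[i]]_k) : cmx_star M = M ->
  (forall v : 'I_k -> R[i], 0 <= \sum_i \sum_j conj (v i) * M i j * v j) ->
  exists Z : 'M[R[i]]_k, M = cmx_star Z *m Z.
Proof.
move=> Ms Mp.
have Mn : M \is normalmx.
  by apply/normalmxP; change (M *m cmx_star M = cmx_star M *m M); rewrite Ms.
have [[P D] /= Pu ME] := elimT (@orthomx_spectral_subproof _ _ M) Mn.
  have PP : P *m cmx_star P = 1%:M by apply/unitarymxP.
  have PV : invmx P = cmx_star P by rewrite invmx_unitary.
  have D0 i : 0 <= D 0 i.
    have := Mp (fun j => conj (P i j)); congr (0 <= _).
    have -> : D 0 i = (P *m M *m cmx_star P) i i.
      rewrite ME PV !mulmxA PP mul1mx -mulmxA PP mulmx1.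
      by rewrite mxE eqxx mulr1n.
    rewrite mxE exchange_big; apply: eq_bigr => j _.
    rewrite !mxE mulr_suml; apply: eq_bigr => l _.
    by rewrite conjCK.
  exists (diag_mx (map_mx sqrtC D) *m P); rewrite ME PV.
  apply/matrixP => i j; rewrite !mxE; apply: eq_bigr => l _.
  rewrite !mul_mx_diag !mul_diag_mx !mxE rmorphM /=.
  rewrite (@conj_Creal _ (sqrtC _)) ?ger0_real ?sqrtC_ge0 //.
  by rewrite mulrACA -expr2 sqrtCK mulrA [D 0 l * _]mulrC.
Qed.

End ComplexMatrices.

Section PositiveFunctionals.

Variables (R : realType) (A : cstarAlgType R).

Definition fpos (tau : A -> R[i]) := forall a, cpos a -> 0 <= tau a.

Lemma fpos_real (tau : {scalar A}) a : fpos tau -> star a = a -> tau a \is Num.real.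
Proof.
move=> tp sa; have := tp _ (cnorm_sub_pos sa).
have h : 0 <= tau ((cnorm a)%:C%:A : A) by apply/tp/cpos_alg/cnorm_ge0.
move=> /ger0_real h1; have := realB (ger0_real h) h1.
by rewrite -linearB opprB addrC subrK.
Qed.

Lemma fpos_star (tau : {scalar A}) a : fpos tau -> tau (star a) = Num.conj (tau a).
Proof.
move=> tp.
pose h := a + star a; pose g := 'i *: (a - star a).
have r1 : tau h \is Num.real by apply: fpos_real; rewrite // starD starK addrC.
have r2 : tau g \is Num.real.
  by apply: fpos_real; rewrite // starZ conjCi starB starK scaleNr -scalerN opprB.
have ig : 'i *: g = star a - a by rewrite scalerA -expr2 sqrCi scaleN1r opprB.
have ah : a + a = h - 'i *: g by rewrite ig opprB addrACA subrr addr0.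
have sh : star a + star a = h + 'i *: g.
  by rewrite ig [RHS]addrC addrA subrK.
move: h g r1 r2 {ig} ah sh => h g r1 r2 ah sh.
have e : Num.conj (tau a + tau a) = tau (star a) + tau (star a).
  rewrite -!linearD ah sh linearB linearD linearZ /= rmorphB rmorphM /= conjCi.
  by rewrite (CrealP r1) (CrealP r2) mulNr opprK.
have two : 2%:R != 0 :> R[i] by rewrite pnatr_eq0.
by apply: (mulfI two); rewrite !mulr_natl !mulr2n -e rmorphD.
Qed.

End PositiveFunctionals.

Lemma sum_pair (V : nmodType) (I J : finType) (F : I * J -> V) :
  \sum_p F p = \sum_i \sum_j F (i, j).
Proof. by rewrite pair_bigA; apply: eq_bigr => -[]. Qed.

Section FiniteIndex.

Variables (R : realType) (K : finType).

(** Matrices of matrices are indexed by pairs, hence this version over a finite type. *)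
Lemma psd_factor_fin (M : K -> K -> R[i]) : (forall i j, M i j = Num.conj (M j i)) ->
  (forall v : K -> R[i], 0 <= \sum_i \sum_j Num.conj (v i) * M i j * v j) ->
  exists Z : K -> K -> R[i], forall i j, M i j = \sum_h Num.conj (Z h i) * Z h j.
Proof.
move=> Ms Mp; pose M' : 'M_#|K| := \matrix_(i, j) M (enum_val i) (enum_val j).
have enumE (V : nmodType) (F : K -> V) : \sum_i F i = \sum_(i < #|K|) F (enum_val i).
  by rewrite (reindex _ (onW_bij _ (@enum_val_bij K))).
have [||Z ZE] := @psd_factor _ _ M'.
- by apply/matrixP => i j; rewrite !mxE -Ms.
- move=> v; have := Mp (fun i => v (enum_rank i)); congr (0 <= _).
  rewrite enumE; apply: eq_bigr => i _; rewrite enumE; apply: eq_bigr => j _.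
  by rewrite !enum_valK mxE.
exists (fun i j => Z (enum_rank i) (enum_rank j)) => i j.
have := congr1 (fun X : 'M_#|K| => X (enum_rank i) (enum_rank j)) ZE.
rewrite !mxE !enum_rankK => ->; rewrite enumE; apply: eq_bigr => h _.
by rewrite !mxE enum_valK.
Qed.

Lemma mx_square_root_fin (A : cstarAlgType R) m (Y : K -> 'I_m -> A) :
  exists W : 'M[A]_m, forall i j,
    \sum_c star (Y c i) * Y c j = (mx_star (@star R A) W *m W) i j.
Proof.
pose Y' : 'M_(#|K|, m) := \matrix_(c, i) Y (enum_val c) i.
have [W WE] := mx_square_root (erefl (mx_star (@star R A) Y' *m Y')).
exists W => i j; rewrite -WE mxE (reindex _ (onW_bij _ (@enum_val_bij K))).
by apply: eq_bigr => c _; rewrite !mxE.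
Qed.

End FiniteIndex.

(** * Block compressions followed by expansions *)

Section Factorization.

Variables (R : realType) (A : cstarAlgType R) (k : nat) (B : finType).
Variables (b : 'I_k -> B) (tau : B -> {scalar A}) (x V : 'I_k -> A).

Local Notation C := R[i].
Local Notation conj := (fun c : C => Num.conj c).

(** The compression of a to the vectors x_f in the direct sum of the GNS spaces of the tau_beta,
    where x_f lies in the summand b f; entries between different summands vanish. *)
Definition compress (a : A) : 'M[C]_k :=
  \matrix_(f, g) (tau (b f) (star (x f) * a * x g) *+ (b f == b g)).

Definition expand (M : 'M[C]_k) : A :=
  \sum_f \sum_g M f g *: (V f * star (V g)).

Fact compress_is_linear : linear compress.
Proof.
move=> c a a'; apply/matrixP => f g; rewrite !mxE mulrDr mulrDl -scalerAr -scalerAl.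
by rewrite linearD linearZ; case: (_ == _); rewrite ?mulr1n // !mulr0n mulr0 addr0.
Qed.

Fact expand_is_linear : linear expand.
Proof.
move=> c M N; rewrite /expand scaler_sumr -big_split; apply: eq_bigr => f _.
rewrite scaler_sumr -big_split; apply: eq_bigr => g _.
by rewrite !mxE scalerDl scalerA.
Qed.

Let X beta (c : 'I_k -> C) : A := \sum_(f | b f == beta) c f *: x f.

Let tauZ beta (c : C) a : tau beta (c *: a) = c * tau beta a.
Proof. by rewrite linearZ. Qed.

(** The form of [compress a] is evaluated inside A, where positivity of the functionals applies;
    both properties of [compress] rest on this. *)
Lemma compress_form a (c d : 'I_k -> C) :
  \sum_f \sum_g conj (c f) * compress a f g * d g =
  \sum_beta tau beta (star (X beta c) * a * X beta d).
Proof.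
rewrite (partition_big b xpredT) //=; apply: eq_bigr => beta _.
rewrite /X star_sum !mulr_suml linear_sum; apply: eq_bigr => f /eqP bf.
rewrite mulr_sumr linear_sum [RHS]big_mkcond; apply: eq_bigr => g _.
rewrite mxE -bf eq_sym; case: eqP => _; last by rewrite mulr0n mulr0 mul0r.
have -> : star (c f *: x f) * a * (d g *: x g) =
    (conj (c f) * d g) *: (star (x f) * a * x g).
  by rewrite starZ -!scalerAl -scalerAr scalerA.
by rewrite mulr1n tauZ mulrAC.
Qed.

Hypothesis tau_pos : forall beta, fpos (tau beta).
(** Sending c to the sum of the c_f x_f is contractive from l^2 of a block to the GNS space. An
    inequality leaves room for blocks with the zero functional. *)
Hypothesis tau_gram : forall beta c,
  tau beta (star (X beta c) * X beta c) <= \sum_(f | b f == beta) conj (c f) * c f.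
Hypothesis V_one : \sum_f V f * star (V f) = 1.

Lemma compress_star a f g : compress (star a) f g = conj (compress a g f).
Proof.
rewrite !mxE eq_sym; case: eqP => [e|_]; last by rewrite !mulr0n rmorph0.
by rewrite !mulr1n -fpos_star // !starM starK mulrA e.
Qed.

(** Flattened to a scalar matrix N over pairs, the image of Y^* Y has as its form a sum of values
    tau_beta(w^* w), where w is a coordinate of Y applied to a vector with entries in the span of
    the x_f. *)
Lemma compress_cp : completely_positive (@star R A) (@cmx_star R k) compress.
Proof.
move=> m _ [Y ->].
pose XY := mx_star (@star R A) Y *m Y.
pose N (i j : 'I_m * 'I_k) := compress (XY i.1 j.1) i.2 j.2.
have XYs a a' : star (XY a a') = XY a' a.
  rewrite !mxE star_sum; apply: eq_bigr => c _.
  by rewrite !mxE starM starK.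
have [||Z ZE] := @psd_factor_fin R _ N.
- by move=> i j; rewrite /N -compress_star XYs.
- move=> v.
  have -> : \sum_i \sum_j conj (v i) * N i j * v j =
      \sum_beta \sum_c tau beta (star (\sum_a Y c a * X beta (fun f => v (a, f))) *
        \sum_a Y c a * X beta (fun f => v (a, f))).
    rewrite sum_pair.
    transitivity (\sum_a \sum_a' \sum_beta
        tau beta (star (X beta (fun f => v (a, f))) * XY a a' *
          X beta (fun f => v (a', f)))).
      apply: eq_bigr => a _; under eq_bigr => f _.
        rewrite sum_pair.
        over.
      by rewrite exchange_big; apply: eq_bigr => a' _; rewrite -compress_form.
    under eq_bigr do rewrite exchange_big.
    rewrite exchange_big; apply: eq_bigr => beta _.
    rewrite -linear_sum; under eq_bigr do rewrite -linear_sum.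
    rewrite -!linear_sum; congr (tau beta _).
    under [RHS]eq_bigr do rewrite star_sum mulr_suml.
    rewrite [RHS]exchange_big; apply: eq_bigr => a _ /=.
    under [RHS]eq_bigr do rewrite mulr_sumr.
    rewrite [RHS]exchange_big; apply: eq_bigr => a' _ /=.
    move: (X beta (fun f => v (a, f))) (X beta (fun f => v (a', f))) => p q.
    rewrite /XY mxE mulr_sumr mulr_suml; apply: eq_bigr => c _.
    by rewrite !mxE starM !mulrA.
  by apply: sumr_ge0 => beta _; apply: sumr_ge0 => c _; apply/tau_pos/cpos_star_mul.
(* Cut back into blocks, the scalar factor of N is a factor over M_k(C). *)
pose W : 'M['M[C]_k]_m := \matrix_(c, a) \matrix_(h, f) Z (c, h) (a, f).
exists W.
apply/matrixP => a a'; apply/matrixP => f g.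
transitivity (N (a, f) (a', g)); first by rewrite mxE.
transitivity ((\sum_c mx_star (@cmx_star R k) W a c *m W c a') f g); last by rewrite mxE.
rewrite ZE sum_pair summxE.
apply: eq_bigr => c _; rewrite !mxE; apply: eq_bigr => h _.
by rewrite !mxE.
Qed.

Lemma compress_contractive a : cmx_norm_le (compress a) (cnorm a).
Proof.
(* Expand 0 <= tau ((a v - u)^* (a v - u)), where u = compress a v. *)
move=> v0; pose v i := v0 i 0; pose u i := (compress a *m v0) i 0.
have uE i : u i = \sum_j compress a i j * v j by rewrite /u mxE.
pose U := \sum_i conj (u i) * u i; pose W := \sum_i conj (v i) * v i.
have sqE (w : 'I_k -> C) : (\sum_i cabs (w i) ^+ 2)%:C = \sum_i conj (w i) * w i.
  by rewrite rmorph_sum; apply: eq_bigr => i _; rewrite /= cabs_sqr mulrC.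
suff h : U <= (cnorm a ^+ 2)%:C * W.
  by rewrite -lecR rmorphM /= !sqE.
have UE : \sum_beta tau beta (star (X beta u) * a * X beta v) = U.
  rewrite -compress_form; apply: eq_bigr => i _.
  by rewrite [X in _ = _ * X]uE mulr_sumr; apply: eq_bigr => j _; rewrite mulrA.
have US : \sum_beta tau beta (star (X beta v) * star a * X beta u) = U.
  have -> : U = conj U.
    by rewrite rmorph_sum; apply: eq_bigr => i _; rewrite rmorphM /= conjCK mulrC.
  rewrite -UE rmorph_sum; apply: eq_bigr => beta _.
  by rewrite /= -fpos_star // !starM starK mulrA.
have gram (w : 'I_k -> C) : \sum_beta tau beta (star (X beta w) * X beta w) <=
    \sum_i conj (w i) * w i.
  by rewrite [leRHS](partition_big b xpredT) //; apply: ler_sum => beta _; exact: tau_gram.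
have h1 : 0 <= \sum_beta tau beta (star (a * X beta v - X beta u) * (a * X beta v - X beta u)).
  by apply: sumr_ge0 => beta _; apply/tau_pos/cpos_star_mul.
have h2 : \sum_beta tau beta (star (a * X beta v) * (a * X beta v)) <= (cnorm a ^+ 2)%:C * W.
  apply: (@le_trans _ _ (\sum_beta (cnorm a ^+ 2)%:C * tau beta (star (X beta v) * X beta v))).
    apply: ler_sum => beta _; rewrite -linearZ -subr_ge0 -linearB.
    apply: tau_pos; rewrite starM -!mulrA mulrA -[_ * (a * _)]mulrA [star a * (a * _)]mulrA.
    by rewrite mulrA; exact: cpos_norm_bound.
  rewrite -mulr_sumr ler_wpM2l ?gram //.
  by rewrite -(rmorph0 (real_complex R)) lecR sqr_ge0.
have h3 : \sum_beta tau beta (star (a * X beta v - X beta u) * (a * X beta v - X beta u)) =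
    \sum_beta tau beta (star (a * X beta v) * (a * X beta v)) - U - U +
    \sum_beta tau beta (star (X beta u) * X beta u).
  rewrite -{1}US -UE -!sumrB -big_split; apply: eq_bigr => beta _ /=.
  rewrite -!linearB -linearD; congr (tau beta _).
  rewrite starB !starM mulrBl !mulrBr !mulrA opprB !addrA.
  by rewrite addrAC.
(* The last term of [h3] is at most U by [gram], so 0 <= ||a||^2 W - U - U + U. *)
move: h1; rewrite h3 => h1.
have := le_trans h1 (lerD (lerD (lerD h2 (lexx (- U))) (lexx (- U))) (gram u)).
by rewrite -/U subrK subr_ge0.
Qed.

(** The image of Y^* Y is a Gram matrix over A with one row for each pair (c, h);
    [mx_square_root_fin] turns this rectangular factor into a square one. *)
Lemma expand_cp : completely_positive (@cmx_star R k) (@star R A) expand.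
Proof.
move=> m _ [Y ->].
pose Zr (ch : 'I_m * 'I_k) a := \sum_f Y ch.1 a ch.2 f *: star (V f).
have [W WE] := mx_square_root_fin Zr; exists W; apply/matrixP => a a'.
rewrite -WE mxE /expand.
rewrite sum_pair.
transitivity (\sum_c \sum_h \sum_f \sum_g
    (conj (Y c a h f) * Y c a' h g) *: (V f * star (V g))).
  transitivity (\sum_f \sum_g \sum_c \sum_h
      (conj (Y c a h f) * Y c a' h g) *: (V f * star (V g))).
    apply: eq_bigr => f _; apply: eq_bigr => g _.
    rewrite mxE summxE scaler_suml; apply: eq_bigr => c _.
    by rewrite !mxE scaler_suml; apply: eq_bigr => h _; rewrite !mxE.
  under eq_bigr do rewrite exchange_big.
  rewrite exchange_big; apply: eq_bigr => c _ /=.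
  under eq_bigr do rewrite exchange_big.
  by rewrite exchange_big.
apply: eq_bigr => c _; apply: eq_bigr => h _.
rewrite star_sum mulr_suml; apply: eq_bigr => f _.
rewrite mulr_sumr; apply: eq_bigr => g _.
by rewrite starZ starK -scalerAl -scalerAr scalerA.
Qed.

Lemma expand_contractive (M : 'M[C]_k) (c : R) :
  0 <= c -> cmx_norm_le M c -> cnorm (expand M) <= c.
Proof.
move=> c0 Mc.
(* The scalar inequality M^* M <= c^2 is transferred to A by writing N = Z^* Z, which becomes a sum
   of squares once applied to the V_g^*. *)
pose N := (c ^+ 2)%:C%:M - cmx_star M *m M.
have [||Z ZE] := @psd_factor R k N.
- apply/matrixP => i j; rewrite !mxE rmorphB rmorphMn /= conj_real eq_sym.
  congr (_ - _); rewrite rmorph_sum; apply: eq_bigr => l _.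
  by rewrite rmorphM /= !mxE conjCK mulrC.
- move=> v; have := Mc (\col_i v i).
  rewrite -lecR rmorphM !rmorph_sum /= -subr_ge0; congr (0 <= _).
  have -> : \sum_i \sum_j conj (v i) * N i j * v j =
      \sum_i (c ^+ 2)%:C * (v i * conj (v i)) -
      \sum_i \sum_j \sum_l conj (M l i * v i) * (M l j * v j).
    rewrite -sumrB; apply: eq_bigr => i _.
    under eq_bigr => j _.
      rewrite !mxE mulrBr mulrBl.
      over.
    rewrite sumrB; congr (_ - _).
      rewrite (bigD1 i) //= eqxx big1 ?addr0 => [|j ji]; last first.
        by rewrite eq_sym (negPf ji) mulr0n mulr0 mul0r.
      by rewrite mulr1n -mulrA mulrCA [_ * v i]mulrC.
    apply: eq_bigr => j _; rewrite mulr_sumr mulr_suml; apply: eq_bigr => l _.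
    by rewrite !mxE rmorphM /= [_ * conj (v i)]mulrC !mulrA.
  congr (_ - _).
    by rewrite mulr_sumr; apply: eq_bigr => i _; rewrite cabs_sqr mxE.
  under [RHS]eq_bigr do rewrite exchange_big.
  rewrite exchange_big; apply: eq_bigr => l _ /=; rewrite cabs_sqr mulrC.
  have -> : (M *m \col_i v i) l 0 = \sum_j M l j * v j.
    by rewrite mxE; apply: eq_bigr => j _; rewrite mxE.
  rewrite rmorph_sum mulr_suml; apply: eq_bigr => i _.
  by rewrite mulr_sumr; apply: eq_bigr => j _.
(* With x = (V_f^* )_f, so that <x, x> = 1, and y = M x, the element
   e = <x, y> satisfies e^* e <= <y, y> <= c^2. *)
pose y f := \sum_g M f g *: star (V g).
have expE : expand M = \sum_f V f * y f.
  apply: eq_bigr => f _; rewrite mulr_sumr; apply: eq_bigr => g _.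
  by rewrite scalerAr.
have Vy : cpos ((c ^+ 2)%:C%:A - \sum_f star (y f) * y f).
  have -> : (c ^+ 2)%:C%:A - \sum_f star (y f) * y f =
      \sum_h star (\sum_g Z h g *: star (V g)) * (\sum_g Z h g *: star (V g)).
    have form (P Q : 'M[C]_k) :
        \sum_f star (\sum_g P f g *: star (V g)) * (\sum_g Q f g *: star (V g)) =
        \sum_g \sum_h (cmx_star P *m Q) g h *: (V g * star (V h)).
      under eq_bigr do rewrite star_sum mulr_suml.
      rewrite exchange_big; apply: eq_bigr => g _ /=.
      under eq_bigr do rewrite mulr_sumr.
      rewrite exchange_big; apply: eq_bigr => h _ /=.
      rewrite mxE scaler_suml; apply: eq_bigr => f _.
      by rewrite !mxE starZ starK -scalerAl -scalerAr scalerA.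
    rewrite form form -ZE -V_one scaler_sumr -sumrB; apply: eq_bigr => g _.
    have -> : (c ^+ 2)%:C *: (V g * star (V g)) =
        \sum_h ((c ^+ 2)%:C%:M g h : C) *: (V g * star (V h)).
      rewrite (bigD1 g) //= big1 ?addr0 => [|h hg]; first by rewrite mxE eqxx.
      by rewrite mxE eq_sym (negPf hg) scale0r.
    rewrite -sumrB; apply: eq_bigr => h _.
    by rewrite [N g h]mxE [X in (_ + X) *: _]mxE scalerBl.
  by apply: cpos_sum => h _; exact: cpos_star_mul.
set e := expand M in expE *.
have h : cpos ((c ^+ 2)%:C%:A - star e * e).
  (* Cauchy-Schwarz as a sum of squares: since the V_f V_f^* add up to 1, the sum is <y, y> - e^*
     e. *)
  have T : cpos (\sum_f star (y f - star (V f) * e) * (y f - star (V f) * e)).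
    by apply: cpos_sum => f _; exact: cpos_star_mul.
  have TE : \sum_f star (y f - star (V f) * e) * (y f - star (V f) * e) =
      \sum_f star (y f) * y f - star e * e.
    have -> : star e * e = \sum_f star (y f) * star (V f) * e.
      rewrite {1}expE star_sum mulr_suml; apply: eq_bigr => f _.
      by rewrite starM.
    rewrite -sumrB.
    have -> : \sum_f star (y f - star (V f) * e) * (y f - star (V f) * e) =
      \sum_f (star (y f) * y f - star (y f) * star (V f) * e) -
      \sum_f (star e * (V f * y f) - star e * (V f * star (V f)) * e).
      rewrite -sumrB; apply: eq_bigr => f _.
      by rewrite starB starM starK mulrBl !mulrBr !mulrA.
    have -> : \sum_f (star e * (V f * y f) - star e * (V f * star (V f)) * e) = 0.
      by rewrite sumrB -mulr_sumr -mulr_suml -mulr_sumr V_one -expE mulr1 subrr.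
    by rewrite subr0.
  by rewrite TE in T; have := cposD Vy T; rewrite addrA subrK.
rewrite -(@ler_pXn2r _ 2) ?nnegrE ?cnorm_ge0 // -cnorm_cstar.
by apply: cnorm_le_alg h; [exact: sqr_ge0|exact: cpos_star_mul].
Qed.

Lemma factorization : exists (phi : {linear A -> 'M[C]_k}) (psi : {linear 'M[C]_k -> A}),
  [/\ completely_positive (@star R A) (@cmx_star R k) phi,
      forall a : A, cmx_norm_le (phi a) (cnorm a),
      completely_positive (@cmx_star R k) (@star R A) psi,
      forall (M : 'M[C]_k) (c : R), 0 <= c -> cmx_norm_le M c -> cnorm (psi M) <= c &
      forall a : A, psi (phi a) =
        \sum_f \sum_g (tau (b f) (star (x f) * a * x g) *+ (b f == b g)) *:
          (V f * star (V g))].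
Proof.
pose phiL := GRing.isLinear.Build _ _ _ _ compress compress_is_linear.
pose psiL := GRing.isLinear.Build _ _ _ _ expand expand_is_linear.
pose phi : {linear A -> 'M[C]_k} := HB.pack compress phiL.
pose psi : {linear 'M[C]_k -> A} := HB.pack expand psiL.
exists phi, psi; split.
- exact: compress_cp.
- exact: compress_contractive.
- exact: expand_cp.
- exact: expand_contractive.
by move=> a; apply: eq_bigr => f _; apply: eq_bigr => g _; rewrite mxE.
Qed.

End Factorization.

(** * Monomials in doubly twisted isometries *)

Section PhaseEquality.

Variables (R : realType) (A : cstarAlgType R).
Implicit Types x y z : A.

(** Reordering generators produces only phases; leaving them unspecified avoids carrying products of
    the z_ij through every identity. *)
Definition qeq x y := exists2 c : R[i], `|c| = 1 & x = c *: y.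

Lemma qeq_refl x : qeq x x.
Proof. by exists 1; rewrite ?normr1 ?scale1r. Qed.

Lemma qeq_eq x y : x = y -> qeq x y.
Proof. by move=> ->; exact: qeq_refl. Qed.

Lemma qeq_trans y x z : qeq x y -> qeq y z -> qeq x z.
Proof.
move=> [c c1 ->] [d d1 ->]; exists (c * d); first by rewrite normrM c1 d1 mulr1.
by rewrite scalerA.
Qed.

Lemma qeq_sym x y : qeq x y -> qeq y x.
Proof.
move=> [c c1 ->]; exists c^-1; first by rewrite normfV c1 invr1.
rewrite scalerA mulVf ?scale1r //; apply: contra_eq_neq c1 => ->.
by rewrite normr0 eq_sym oner_eq0.
Qed.

Lemma qeqM x y x' y' : qeq x x' -> qeq y y' -> qeq (x * y) (x' * y').
Proof.
move=> [c c1 ->] [d d1 ->]; exists (c * d); first by rewrite normrM c1 d1 mulr1.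
by rewrite -scalerAl -scalerAr scalerA.
Qed.

Lemma qeq_star x y : qeq x y -> qeq (star x) (star y).
Proof. by move=> [c c1 ->]; exists (Num.conj c); rewrite ?norm_conjC ?starZ. Qed.

Definition qcomm x y := qeq (x * y) (y * x).

Lemma qcomm_sym x y : qcomm x y -> qcomm y x.
Proof. exact: qeq_sym. Qed.

Lemma qcomm1 x : qcomm x 1.
Proof. by rewrite /qcomm mulr1 mul1r; exact: qeq_refl. Qed.

Lemma qcommM x y z : qcomm x y -> qcomm x z -> qcomm x (y * z).
Proof.
move=> xy xz; rewrite /qcomm mulrA.
apply: qeq_trans (qeqM xy (qeq_refl z)) _; rewrite -!mulrA.
exact: qeqM (qeq_refl y) xz.
Qed.

Lemma qcommX x y a : qcomm x y -> qcomm x (y ^+ a).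
Proof.
move=> xy; elim: a => [|a IH]; first by rewrite expr0; exact: qcomm1.
by rewrite exprS; exact: qcommM.
Qed.

Lemma qcomm_prod (I : Type) (r : seq I) (F : I -> A) x :
  (forall i, qcomm x (F i)) -> qcomm x (\prod_(i <- r) F i).
Proof. by move=> H; apply: (big_ind (qcomm x)); [exact: qcomm1|exact: qcommM|]. Qed.

Lemma qeq_prodM (I : Type) (r : seq I) (F G : I -> A) :
  (forall i j, qcomm (F i) (G j)) ->
  qeq (\prod_(i <- r) F i * \prod_(i <- r) G i) (\prod_(i <- r) (F i * G i)).
Proof.
move=> FG; elim: r => [|i r IH]; first by rewrite !big_nil mulr1; exact: qeq_refl.
rewrite !big_cons -!mulrA [_ * (G i * _)]mulrA.
apply: (@qeq_trans (F i * (G i * \prod_(j <- r) F j * \prod_(j <- r) G j))).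
  apply: qeqM (qeq_refl _) (qeqM _ (qeq_refl _)).
  by apply/qcomm_sym/qcomm_prod => j; exact/qcomm_sym.
by rewrite -mulrA; apply: qeqM (qeq_refl _) (qeqM (qeq_refl _) IH).
Qed.

Lemma isometry_prod (I : Type) (r : seq I) (F : I -> A) :
  (forall i, star (F i) * F i = 1) ->
  star (\prod_(i <- r) F i) * \prod_(i <- r) F i = 1.
Proof.
move=> H; apply: (big_ind (fun x => star x * x = 1)) => //; first by rewrite star1 mulr1.
by move=> x y xx yy; rewrite starM -mulrA [star x * _]mulrA xx mul1r.
Qed.

(* If u x = a x u and u^* x = b x u^* then, u being isometric, x = u^* u x =
   a b x, so that a b = 1. *)
Lemma range_proj_comm u x : star u * u = 1 -> star x * x = 1 -> qcomm u x ->
  qcomm (star u) x -> u * star u * x = x * (u * star u).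
Proof.
move=> uu xx [c c1 ux] [d d1 usx].
have cd : c * d = 1.
  have : (c * d) *: x = x.
    rewrite -{2}[x]mul1r -uu -mulrA ux -scalerAr mulrA usx -scalerAl scalerA.
    by rewrite -mulrA uu mulr1.
  move=> /(congr1 (fun y => star x * y)); rewrite -scalerAr xx => /eqP.
  by rewrite -{2}[1]scale1r -subr_eq0 -scalerBl scaler_eq0 oner_eq0 orbF subr_eq0 => /eqP.
rewrite -mulrA usx -scalerAr (mulrA u x) ux -scalerAl scalerA [d * c]mulrC cd.
by rewrite scale1r mulrA.
Qed.

End PhaseEquality.

Section Monomials.

Variables (R : realType) (A : cstarAlgType R) (n : nat) (s : 'I_n -> A).
Hypothesis s_iso : forall i, star (s i) * s i = 1.
Hypothesis s_qcomm : forall i j, qcomm (s i) (s j).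
Hypothesis star_qcomm : forall i j, i != j -> qcomm (star (s i)) (s j).

Implicit Types (al be ga de : 'I_n -> nat) (J : pred 'I_n).

Lemma iso_exp i a : star (s i ^+ a) * s i ^+ a = 1.
Proof.
elim: a => [|a IH]; first by rewrite expr0 star1 mulr1.
by rewrite exprS starM -mulrA [star (s i) * _]mulrA s_iso mul1r.
Qed.

Lemma pow_qcomm i j a c : qcomm (s i ^+ a) (s j ^+ c).
Proof. by apply/qcommX/qcomm_sym/qcommX/qcomm_sym. Qed.

Lemma star_pow_qcomm i j a c : i != j -> qcomm (star (s i ^+ a)) (s j ^+ c).
Proof. by move=> ij; rewrite starX; apply/qcommX/qcomm_sym/qcommX/qcomm_sym/star_qcomm. Qed.

Definition mono al : A := \prod_(i < n) s i ^+ al i.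

Lemma eq_mono al be : al =1 be -> mono al = mono be.
Proof. by move=> e; apply: eq_bigr => i _; rewrite e. Qed.

Lemma mono0 al : al =1 (fun=> 0%N) -> mono al = 1.
Proof. by move=> e; apply: big1 => i _; rewrite e. Qed.

Lemma monoM al be : qeq (mono al * mono be) (mono (fun i => al i + be i)%N).
Proof.
apply: qeq_trans (qeq_prodM _ _) _ => [i j|]; first exact: pow_qcomm.
by apply: qeq_eq; apply: eq_bigr => i _; rewrite exprD.
Qed.

Lemma iso_mono al : star (mono al) * mono al = 1.
Proof. by apply: isometry_prod => i; exact: iso_exp. Qed.

Lemma star_mono_disjoint al be : (forall i, al i = 0%N \/ be i = 0%N) ->
  qeq (star (mono al) * mono be) (mono be * star (mono al)).
Proof.
move=> disj; apply: qcomm_prod => j.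
apply: (big_ind (fun x => qcomm (star x) (s j ^+ be j))).
- by rewrite star1; apply/qcomm_sym/qcomm1.
- by move=> x y xs ys; rewrite starM; apply/qcomm_sym/qcommM; exact/qcomm_sym.
move=> i _; have [<-|ij] := eqVneq i j; last exact: star_pow_qcomm.
case: (disj i) => ->; rewrite expr0 ?star1; last exact: qcomm1.
exact/qcomm_sym/qcomm1.
Qed.

(** The common factor with exponents min(be, ga) is an isometry and cancels. The truncated
    differences that remain have disjoint supports, so the two factors commute up to a phase. *)
Lemma star_mono_mono be ga :
  qeq (star (mono be) * mono ga)
      (mono (fun i => ga i - be i)%N * star (mono (fun i => be i - ga i)%N)).
Proof.
pose m i := minn (be i) (ga i).
have bE : qeq (mono be) (mono m * mono (fun i => be i - ga i)%N).
  apply/qeq_sym/(qeq_trans (monoM _ _))/qeq_eq/eq_mono => i.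
  by rewrite /m; lia.
have gE : qeq (mono ga) (mono m * mono (fun i => ga i - be i)%N).
  by apply/qeq_sym/(qeq_trans (monoM _ _))/qeq_eq/eq_mono => i; rewrite /m; lia.
apply: qeq_trans (qeqM (qeq_star bE) gE) _.
rewrite starM -mulrA [star (mono m) * _]mulrA iso_mono mul1r.
by apply: star_mono_disjoint => i; lia.
Qed.

Lemma monomialM al be ga de :
  qeq (mono al * star (mono be) * (mono ga * star (mono de)))
      (mono (fun i => al i + (ga i - be i))%N * star (mono (fun i => de i + (be i - ga i))%N)).
Proof.
rewrite -mulrA [star _ * (_ * _)]mulrA.
apply: qeq_trans (qeqM (qeq_refl _) (qeqM (star_mono_mono _ _) (qeq_refl _))) _.
rewrite -[_ * star (mono de)]mulrA -starM mulrA.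
by apply: qeqM; [exact: monoM|apply/qeq_star/monoM].
Qed.

Definition rproj i c : A := s i ^+ c * star (s i ^+ c).

Lemma rproj0 i : rproj i 0 = 1.
Proof. by rewrite /rproj expr0 star1 mulr1. Qed.

Lemma star_rproj i c : star (rproj i c) = rproj i c.
Proof. by rewrite starM starK. Qed.

(** The relation is exact, with no phase; for i != j this is [range_proj_comm]. For i = j and a >= c
    the truncated exponent 0 gives the projection 1, as the range of s_i^a lies in that of s_i^c. *)
Lemma rproj_pow i c j a :
  rproj i c * s j ^+ a = s j ^+ a * rproj i (c - a * (i == j)).
Proof.
have [<-|ij] := eqVneq i j; last first.
  rewrite muln0 subn0; apply: range_proj_comm; rewrite ?iso_exp //.
    exact: pow_qcomm.
  exact: star_pow_qcomm.
rewrite muln1 /rproj -mulrA; have [ac|/ltnW ca] := leqP a c; last first.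
  rewrite -{1}(subnKC ca) exprD [star _ * _]mulrA iso_exp mul1r -exprD subnKC //.
  by move: ca; rewrite -subn_eq0 => /eqP->; rewrite expr0 star1 !mulr1.
by rewrite -{1 2}(subnKC ac) exprD starM -!mulrA iso_exp mulr1.
Qed.

Lemma rproj_mono i c al : rproj i c * mono al = mono al * rproj i (c - al i).
Proof.
have H (r : seq 'I_n) : rproj i c * \prod_(j <- r) s j ^+ al j =
    \prod_(j <- r) s j ^+ al j * rproj i (c - \sum_(j <- r) al j * (i == j)).
  elim: r c => [|j r IH] d; first by rewrite !big_nil mulr1 mul1r subn0.
  by rewrite !big_cons mulrA rproj_pow -mulrA IH mulrA subnDA.
rewrite /mono H; congr (_ * rproj i (c - _)).
rewrite (bigD1 i) //= eqxx muln1 big1 ?addn0 // => j ji.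
by rewrite eq_sym (negPf ji) muln0.
Qed.

Lemma rproj_star_mono i c al :
  rproj i c * star (mono al) = star (mono al) * rproj i (c + al i).
Proof.
have := congr1 star (rproj_mono i (c + al i) al).
by rewrite addnK starM [RHS]starM !star_rproj.
Qed.

Lemma rproj_monomial i c al be : rproj i c * (mono al * star (mono be)) =
  mono al * star (mono be) * rproj i (c - al i + be i).
Proof. by rewrite mulrA rproj_mono -mulrA rproj_star_mono mulrA. Qed.

Lemma rprojM i c d : rproj i c * rproj i d = rproj i (maxn c d).
Proof.
rewrite {2}/rproj mulrA rproj_pow eqxx muln1 /rproj mulrA -exprD.
rewrite -mulrA -starM -exprD; congr (s i ^+ _ * star (s i ^+ _)); lia.
Qed.

Lemma rproj_comm i c j d : GRing.comm (rproj i c) (rproj j d).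
Proof.
have [<-|ij] := eqVneq i j; first by rewrite /GRing.comm !rprojM maxnC.
have cs : rproj i c * s j ^+ d = s j ^+ d * rproj i c.
  by rewrite rproj_pow (negPf ij) muln0 subn0.
have cs' := congr1 star cs; rewrite starM [RHS]starM star_rproj in cs'.
by rewrite /GRing.comm /(rproj j d) mulrA cs -mulrA -cs' mulrA.
Qed.

Lemma mono_star_mono al : mono al * star (mono al) = \prod_(i < n) rproj i (al i).
Proof.
rewrite /mono; elim: (index_enum _) (index_enum_uniq 'I_n) => [|i r IH] /=.
  by rewrite !big_nil star1 mulr1.
move=> /andP[ir ur]; rewrite !big_cons starM mulrA -[_ * \prod_(j <- r) s j ^+ _ * _]mulrA.
rewrite IH // -mulrA.
have -> : (\prod_(j <- r) rproj j (al j)) * star (s i ^+ al i) =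
    star (s i ^+ al i) * \prod_(j <- r) rproj j (al j).
  symmetry; rewrite big_seq; apply: commr_prod => j jr.
  have ji : j != i by apply: contraNneq ir => <-.
  have := congr1 star (rproj_pow j (al j) i (al i)).
  by rewrite (negPf ji) muln0 subn0 starM [RHS]starM !star_rproj.
by rewrite mulrA.
Qed.

(* Equal to s_i^c (1 - s_i s_i^* ) s_i^*c, hence 0 when s_i is unitary. *)
Definition sproj i c : A := rproj i c - rproj i c.+1.

Lemma sproj_rproj i c : sproj i c * rproj i c = sproj i c.
Proof. by rewrite mulrBl !rprojM maxnn; congr (_ - rproj i _); lia. Qed.

Lemma star_sproj i c : star (sproj i c) = sproj i c.
Proof. by rewrite starB !star_rproj. Qed.

Lemma sproj_mono i al : sproj i (al i) * mono al = mono al * sproj i 0.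
Proof.
rewrite mulrBl mulrBr !rproj_mono subnn; congr (_ - _ * rproj i _); lia.
Qed.

Lemma sproj_rproj_comm i c j d : GRing.comm (sproj i c) (rproj j d).
Proof. by apply/commr_sym; apply: commrB; exact: rproj_comm. Qed.

Lemma sproj_comm i c j d : GRing.comm (sproj i c) (sproj j d).
Proof. by apply: commrB; exact: sproj_rproj_comm. Qed.

Definition defect J : A := \prod_(i < n) (if J i then sproj i 0 else 1).

Lemma mono_defect J al :
  mono al * defect J = (\prod_(i < n) (if J i then sproj i (al i) else 1)) * mono al.
Proof.
rewrite /defect; elim: (index_enum _) => [|i r IH].
  by rewrite !big_nil mulr1 mul1r.
rewrite !big_cons mulrA.
have -> : mono al * (if J i then sproj i 0 else 1) =
    (if J i then sproj i (al i) else 1) * mono al.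
  by case: (J i); rewrite ?sproj_mono // mulr1 mul1r.
by rewrite -mulrA IH mulrA.
Qed.

Lemma defect_idem J : defect J * defect J = defect J.
Proof.
rewrite /defect -prodrM_comm => [|i j _ _].
  apply: eq_bigr => i _; case: (J i); last by rewrite mulr1.
  by rewrite {2}/sproj mulrBr sproj_rproj [X in _ - X]mulrBl !rprojM subrr subr0.
by case: (J i); case: (J j); rewrite /GRing.comm ?mulr1 ?mul1r //; exact: sproj_comm.
Qed.

Lemma star_defect J : star (defect J) = defect J.
Proof.
rewrite /defect.
have H (r : seq 'I_n) : star (\prod_(i <- r) (if J i then sproj i 0 else 1)) =
    \prod_(i <- r) (if J i then sproj i 0 else 1).
  elim: r => [|i r IH]; first by rewrite !big_nil star1.
  rewrite !big_cons starM IH; symmetry.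
  have -> : star (if J i then sproj i 0 else 1) = if J i then sproj i 0 else 1.
    by case: (J i); rewrite ?star_sproj ?star1.
  apply: commr_prod => j _.
  by case: (J i); case: (J j); rewrite /GRing.comm ?mulr1 ?mul1r //; exact: sproj_comm.
exact: H.
Qed.

(** For i in J the factors are differences of consecutive range projections, so that sums over al
    telescope coordinate by coordinate. *)
Lemma mono_defect_star_mono J al : mono al * defect J * star (mono al) =
  \prod_(i < n) (if J i then sproj i (al i) else rproj i (al i)).
Proof.
rewrite mono_defect -mulrA mono_star_mono -prodrM_comm => [|i j _ _].
  by apply: eq_bigr => i _; case: (J i); rewrite ?sproj_rproj // mul1r.
case: (J i); last by rewrite /GRing.comm mulr1 mul1r.
exact: sproj_rproj_comm.
Qed.

Lemma rproj1_defect J i : J i -> rproj i 1 * defect J = 0.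
Proof.
move=> Ji; rewrite /defect.
elim: (index_enum _) (mem_index_enum i) => [//|j r IH].
rewrite inE big_cons => /predU1P[<-|/IH ir].
  by rewrite Ji mulrA mulrBr !rprojM subrr mul0r.
have -> : forall y, rproj i 1 * ((if J j then sproj j 0 else 1) * y) =
    (if J j then sproj j 0 else 1) * (rproj i 1 * y).
  move=> y; rewrite mulrA [RHS]mulrA; congr (_ * y); case: (J j); last by rewrite mulr1 mul1r.
  by symmetry; exact: sproj_rproj_comm.
by rewrite ir mulr0.
Qed.

Lemma star_mono_defect0 J al i : J i -> (0 < al i)%N -> star (mono al) * defect J = 0.
Proof.
move=> Ji ai.
have r1 : rproj i 1 * mono al = mono al.
  rewrite rproj_mono (_ : 1 - al i = 0)%N ?rproj0 ?mulr1 //; lia.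
by rewrite -r1 starM star_rproj -mulrA rproj1_defect ?mulr0.
Qed.

End Monomials.

(** * Gauge averages and states *)

Section ComplexCompleteness.

Variable R : realType.

Lemma real_cauchy_rate (x : nat -> R) :
  (forall k p, `|x (k + p)%N - x k| <= rate R k) ->
  exists y, forall k, `|x k - y| <= rate R k.
Proof.
(* The limit is the supremum of these lower bounds, all of which lie below every x_l + [rate l]. *)
move=> xC; pose S : set R := fun y => exists k, y = x k - rate R k.
have le k l : x k - rate R k <= x l + rate R l.
  have := xC k l; have := xC l k; rewrite addnC !ler_norml => /andP[a1 a2] /andP[a3 a4]; lra.
have S0 : nonempty S by exists (x 0%N - rate R 0%N), 0%N.
have ub l : ubound S (x l + rate R l) by move=> _ [k ->].
exists (sup S) => k; rewrite ler_norml; apply/andP; split.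
  by have : sup S <= x k + rate R k by [exact: ge_sup]; lra.
have : x k - rate R k <= sup S; last by lra.
by apply: ub_le_sup; [exists (x 0%N + rate R 0%N)|exists k].
Qed.

Lemma complex_cauchy_rate (c : nat -> R[i]) :
  (forall k p, cabs (c (k + p)%N - c k) <= rate R k) ->
  exists d, forall k, cabs (c k - d) <= 2 * rate R k.
Proof.
move=> cC.
have re_le (z : R[i]) : `|complex.Re z| <= cabs z.
  by rewrite -lecR cabs_norm; exact: normc_ge_Re.
have im_le (z : R[i]) : `|complex.Im z| <= cabs z.
  have -> : complex.Im z = - complex.Re (z * 'i%C) by rewrite ReiNIm opprK.
  rewrite normrN (le_trans (re_le _)) // -lecR !cabs_norm normrM.
  by rewrite [`|'i%C|]normc_def /= expr0n expr1n add0r sqrtr1 mulr1.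
have [x xP] : exists x, forall k, `|complex.Re (c k) - x| <= rate R k.
  by apply: real_cauchy_rate => k p; rewrite -raddfB (le_trans (re_le _)).
have [y yP] : exists y, forall k, `|complex.Im (c k) - y| <= rate R k.
  by apply: real_cauchy_rate => k p; rewrite -raddfB (le_trans (im_le _)).
exists (x +i* y)%C => k; rewrite -lecR cabs_norm.
have -> : c k - (x +i* y)%C = (complex.Re (c k) - x)%:C + 'i%C * (complex.Im (c k) - y)%:C.
  by rewrite [LHS]complexE !raddfB.
apply: le_trans (ler_normD _ _) _; rewrite normrM -!cabs_norm !cabs_real.
have -> : cabs ('i%C : R[i]) = 1.
  by apply: cabs_unit; rewrite normc_def /= expr0n expr1n add0r sqrtr1.
by rewrite mul1r -rmorphD lecR; have := xP k; have := yP k; lra.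
Qed.

End ComplexCompleteness.

(** * Positive contractive maps *)

Section PositiveMaps.

Variables (R : realType) (A : cstarAlgType R).

Definition posmap (L : A -> A) :=
  [/\ linear L, forall a, cpos a -> cpos (L a) & forall a, cnorm (L a) <= cnorm a].

Lemma posmap_id : posmap id.
Proof. by split. Qed.

Lemma posmap_comp L M : posmap L -> posmap M -> posmap (L \o M).
Proof.
move=> [Ll Lp Lc] [Ml Mp Mc]; split=> [c a b|a /Mp/Lp //|a] /=.
  by rewrite Ml Ll.
exact: le_trans (Lc _) (Mc _).
Qed.

Lemma posmap_conj y : cnorm y <= 1 -> posmap (fun a => star y * a * y).
Proof.
move=> y1; split=> [c a b|a|a].
- by rewrite mulrDr mulrDl -scalerAr -scalerAl.
- exact: cpos_conj.
apply: le_trans (cnormM _ _) _; rewrite -[leRHS]mulr1.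
apply: ler_pM; rewrite ?cnorm_ge0 //; apply: le_trans (cnormM _ _) _.
by rewrite cnorm_star -[leRHS]mul1r ler_pM ?cnorm_ge0.
Qed.

Lemma star_morph_posmap (f : {lrmorphism A -> A}) :
  (forall x, f (star x) = star (f x)) -> posmap f.
Proof.
move=> fs; have fp a : cpos a -> cpos (f a).
  by case=> w ws ->; exists (f w); rewrite -?fs ?ws ?rmorphM.
split=> // [c a b|a]; first by rewrite linearP.
rewrite -(@ler_pXn2r _ 2) ?nnegrE ?cnorm_ge0 // -cnorm_cstar.
apply: cnorm_le_alg; [exact: sqr_ge0|exact: cpos_star_mul|].
have -> : (cnorm a ^+ 2)%:C%:A - star (f a) * f a =
    f ((cnorm a ^+ 2)%:C%:A - star a * a).
  by rewrite linearB linearZ /= rmorph1 -fs -rmorphM.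
by apply: fp; rewrite -cnorm_cstar; apply: cnorm_sub_pos; rewrite starM starK.
Qed.

Lemma posmap_half L M : posmap L -> posmap M ->
  posmap (fun a => 2^-1%:C *: (L a + M a)).
Proof.
move=> [Ll Lp Lc] [Ml Mp Mc]; split=> [c a b|a ap|a].
- by rewrite Ll Ml addrACA -scalerDr [LHS]scalerDr; congr (_ + _); rewrite !scalerA mulrC.
- by apply: cposZ; [rewrite invr_ge0|apply: cposD; [exact: Lp|exact: Mp]].
rewrite cnormR ger0_norm ?invr_ge0 //.
by have := cnormD (L a) (M a); have := Lc a; have := Mc a; lra.
Qed.

End PositiveMaps.

Section DyadicRoots.

Variable R : realType.

(** Averages over such roots of unity replace integration over the torus: they separate exponents
    modulo 2^N, which is enough for monomials of bounded degree. *)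
Lemma dyadic_root k : exists2 w : R[i], `|w| = 1 & w ^+ (2 ^ k) = -1.
Proof.
elim: k => [|k [w w1 wE]]; first by exists (-1); rewrite ?normrN1.
exists (sqrtC w); last by rewrite expnS exprM sqrtCK.
by apply/eqP; rewrite -(@eqrXn2 _ 2%N) // -normrX sqrtCK w1 expr1n.
Qed.

Lemma phase_diff (w : R[i]) a b : `|w| = 1 -> (b <= a)%N ->
  w ^+ a * Num.conj w ^+ b = w ^+ (a - b).
Proof.
move=> w1 ba; rewrite -{1}(subnK ba) exprD -mulrA -exprMn -normCK w1 !expr1n.
by rewrite mulr1.
Qed.

(** Here a - b is an odd multiple of 2^k, so averaging with w removes the monomial. *)
Lemma dyadic_phase k (w : R[i]) a b : `|w| = 1 -> w ^+ (2 ^ k) = -1 ->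
  a = b %[mod 2 ^ k] -> a <> b %[mod 2 ^ k.+1] -> w ^+ a * Num.conj w ^+ b = -1.
Proof.
move=> w1 wk.
wlog ba : a b / (b <= a)%N => [H e ne|/eqP e /eqP ne].
  case/orP: (leq_total b a) => ab; first exact: H.
  have := H b a ab (esym e) (fun x => ne (esym x)).
  move/(congr1 Num.conj); rewrite rmorphM !rmorphXn /= conjCK rmorphN1 mulrC.
  by [].
rewrite phase_diff //.
move: e ne; rewrite !eqn_mod_dvd // => /dvdnP[m ->]; rewrite expnS.
rewrite dvdn_pmul2r ?expn_gt0 // => m2.
by rewrite mulnC exprM wk -signr_odd; move: m2; rewrite dvdn2 negbK => ->.
Qed.

End DyadicRoots.

Section GaugeState.

Variables (R : realType) (A : cstarAlgType R) (n : nat) (s : 'I_n -> A).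
Hypothesis s_iso : forall i, star (s i) * s i = 1.
Hypothesis s_qcomm : forall i j, qcomm (s i) (s j).
Hypothesis star_qcomm : forall i j, i != j -> qcomm (star (s i)) (s j).
Hypothesis gauge : forall w : 'I_n -> R[i], (forall i, `|w i| = 1) ->
  exists f : {lrmorphism A -> A},
    (forall x, f (star x) = star (f x)) /\ (forall i, f (s i) = w i *: s i).

Implicit Types (al be ga de : 'I_n -> nat).

Local Notation mon al be := (mono s al * star (mono s be)).

Lemma gauge_coord i (w : R[i]) : `|w| = 1 -> exists2 L : A -> A, posmap L &
  forall al be, L (mon al be) = ((1 + w ^+ al i * Num.conj w ^+ be i) / 2%:R) *: mon al be.
Proof.
move=> w1; pose v j := if j == i then w else 1.
have [|f [fs fv]] := gauge (w := v).
  by move=> j; rewrite /v; case: eqP; rewrite ?normr1.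
exists (fun a => 2^-1%:C *: (id a + f a)).
  by apply: posmap_half; [exact: posmap_id|exact: star_morph_posmap].
have fm al : f (mono s al) = w ^+ al i *: mono s al.
  rewrite rmorph_prod /mono.
  under eq_bigr do rewrite rmorphXn /= fv exprZn.
  rewrite scaler_prod (bigD1 i) //= big1 ?mulr1 => [|j ji]; first by rewrite /v eqxx.
  by rewrite /v (negPf ji) expr1n.
move=> al be; rewrite rmorphM /= fs !fm starZ rmorphXn -scalerAl -scalerAr scalerA.
by rewrite -{1}[mon al be]scale1r -scalerDl scalerA fmorphV rmorph_nat mulrC.
Qed.

Definition diag_on (L : A -> A) (P Q : ('I_n -> nat) -> ('I_n -> nat) -> Prop) :=
  forall al be, exists c : R[i],
    [/\ L (mon al be) = c *: mon al be, P al be -> c = 1 & Q al be -> c = 0].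

(** One two-term average for each binary digit: the N-th removes the pairs that agree modulo 2^N but
    not modulo 2^(N + 1). *)
Lemma gauge_coord_avg i N : exists2 L, posmap L &
  diag_on L (fun al be => al i = be i) (fun al be => al i <> be i %[mod 2 ^ N]).
Proof.
elim: N => [|N [L Lp LE]].
  exists id; first exact: posmap_id.
  by move=> al be; exists 1; split=> [|//|]; [rewrite scale1r|rewrite expn0 !modn1].
have [w w1 wE] := dyadic_root R N; have [M Mp ME] := gauge_coord i w1.
exists (M \o L); first exact: posmap_comp.
move=> al be; have [c [Lc c1 c0]] := LE al be.
have [Ml _ _] := Mp.
have M0 : M 0 = 0 by have := Ml (-1) 0 0; rewrite scaler0 addr0 scaleN1r addNr.
exists (c * ((1 + w ^+ al i * Num.conj w ^+ be i) / 2%:R)); split.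
- by rewrite /= Lc -[c *: _]addr0 Ml M0 addr0 ME scalerA.
- move=> e; rewrite c1 // e mul1r phase_diff // subnn expr0.
  by rewrite -mulr2n divff ?pnatr_eq0.
move=> ne; have [e|/eqP/c0->] := eqVneq (al i %% 2 ^ N)%N (be i %% 2 ^ N)%N.
  by rewrite (dyadic_phase w1 wE e ne) subrr mul0r mulr0.
by rewrite mul0r.
Qed.

Lemma gauge_avg N : exists2 L, posmap L &
  diag_on L (fun al be => al =1 be) (fun al be => exists i, al i <> be i %[mod 2 ^ N]).
Proof.
have H (r : seq 'I_n) : exists2 L, posmap L & diag_on L (fun al be => al =1 be)
    (fun al be => exists2 i, i \in r & al i <> be i %[mod 2 ^ N]).
  elim: r => [|i r [L Lp LE]].
    exists id; first exact: posmap_id.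
    by move=> al be; exists 1; split; rewrite ?scale1r // => -[].
  have [M Mp ME] := gauge_coord_avg i N.
  exists (M \o L); first exact: posmap_comp.
  move=> al be; have [c [Lc c1 c0]] := LE al be; have [d [Md d1 d0]] := ME al be.
  have [Ml _ _] := Mp.
  have M0 : M 0 = 0 by have := Ml (-1) 0 0; rewrite scaler0 addr0 scaleN1r addNr.
  exists (c * d); split.
  - by rewrite /= Lc -[c *: _]addr0 Ml M0 addr0 Md scalerA.
  - by move=> e; rewrite c1 // d1 ?mulr1.
  move=> [j]; rewrite inE => /predU1P[->|jr] ne; first by rewrite d0 // mulr0.
  by rewrite c0 ?mul0r //; exists j.
have [L Lp LE] := H (enum 'I_n); exists L => // al be.
have [c [cE c1 c0]] := LE al be; exists c; split=> // -[i ne].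
by apply: c0; exists i; rewrite ?mem_enum.
Qed.

Variable J : pred 'I_n.

Local Notation D := (defect s J).

Definition diagonal al be := [forall i, (al i == be i) && (J i ==> (al i == 0%N))].

Definition degree al := (\sum_i al i)%N.

Lemma degree_le al i : (al i <= degree al)%N.
Proof. by rewrite /degree (bigD1 i) //= leq_addr. Qed.

Lemma cnorm_iso (u : A) : star u * u = 1 -> cnorm u = 1.
Proof.
move=> uu; apply/eqP; rewrite -(@eqrXn2 _ 2%N) ?cnorm_ge0 //.
by rewrite -cnorm_cstar uu cnorm1 expr1n.
Qed.

Lemma cnorm_proj_le (u : A) : star u * u = u -> cnorm u <= 1.
Proof.
move=> uu; have := cnorm_cstar u; rewrite uu => e.
have [->//|u0] := eqVneq (cnorm u) 0.
by rewrite -(@ler_pM2l _ (cnorm u)) ?lt0r ?u0 ?cnorm_ge0 // mulr1 -expr2 -e.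
Qed.

Lemma star_defect_defect : star D * D = D.
Proof. by rewrite star_defect // defect_idem. Qed.

(* The limit of these maps is tau (a) D: the isometry t moves a far away from the
   defect of the s_i with i outside J, where they act as unitaries. *)
Lemma corner_map N : exists2 L, posmap L & forall al be,
  (degree al < N)%N -> (degree be < N)%N ->
  L (mon al be) = (diagonal al be)%:R *: D.
Proof.
have [E Ep EE] := gauge_avg N.
(* Off J the exponent N exceeds those of the monomials considered, so that s^t absorbs s^al; on J it
   is 0, so that a factor s_i^* reaches the defect and vanishes. *)
pose t i := if J i then 0%N else N.
pose y := mono s t * D.
have y1 : cnorm y <= 1.
  apply: le_trans (cnormM _ _) _; rewrite cnorm_iso ?iso_mono // mul1r.
  exact/cnorm_proj_le/star_defect_defect.
exists ((fun a => star y * a * y) \o E).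
  by apply: posmap_comp => //; exact: posmap_conj.
move=> al be alN beN /=; have [c [cE c1 c0]] := EE al be.
(* Below 2^N, congruence modulo 2^N is equality. *)
have lt ga i : (degree ga < N)%N -> (ga i < 2 ^ N)%N.
  by move=> gN; apply: leq_ltn_trans (degree_le ga i) (ltn_trans gN (ltn_expl _ _)).
rewrite cE -scalerAr -scalerAl.
have kill ga : (exists2 i, J i & (0 < ga i)%N) -> star (mono s ga) * y = 0.
  move=> [i Ji gi]; rewrite /y mulrA.
  have [d _ ->] := star_mono_mono s_iso s_qcomm star_qcomm ga t.
  rewrite -scalerAl -mulrA (star_mono_defect0 s_iso s_qcomm star_qcomm Ji).
    by rewrite mulr0 scaler0.
  by rewrite /t Ji subn0.
have [/forallP dg|] := boolP (diagonal al be); last first.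
  rewrite negb_forall scale0r => /existsP[j]; rewrite negb_and.
  have [aE|ne _] := eqVneq (al j) (be j); last first.
    rewrite c0 ?scale0r //; exists j => /eqP.
    by rewrite !modn_small ?lt // (negPf ne).
  rewrite negb_imply -lt0n /= => /andP[Jj aj].
  by rewrite -!mulrA kill ?mulr0 ?scaler0 //; exists j; rewrite -?aE.
have aE : al =1 be by move=> i; have /andP[/eqP] := dg i.
rewrite c1 // !scale1r -(eq_mono s aE).
have [d d1 tE] := monoM s_qcomm al (fun i => t i - al i)%N.
have {}tE : qeq (mono s t) (mono s al * mono s (fun i => t i - al i)%N).
  apply/qeq_sym; exists d => //; rewrite tE; congr (_ *: _); apply: eq_mono => i.
  rewrite subnKC // /t; have /andP[_ /implyP Ji] := dg i.
  by case: (J i) Ji => [/(_ isT)/eqP->//|_]; rewrite ltnW // (leq_ltn_trans (degree_le al i)).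
have [e e1 {}tE] := tE.
have saty : star (mono s al) * y = e *: (mono s (fun i => t i - al i)%N * D).
  by rewrite /y tE -scalerAl -scalerAr mulrA mulrA iso_mono // mul1r -?scalerAl.
have -> : star y * (mono s al * star (mono s al)) * y =
    star (star (mono s al) * y) * (star (mono s al) * y).
  by rewrite [star (star _ * y)]starM starK !mulrA.
rewrite saty starZ -scalerAl -scalerAr scalerA mulrC -normCK e1 expr1n scale1r.
by rewrite starM -mulrA [star (mono _ _) * _]mulrA iso_mono // mul1r star_defect_defect.
Qed.

(** The linear span of the monomials, closed under products by [monomialM]; terms are added one at a
    time for induction. *)
Inductive mspan : A -> Prop :=
| mspan0 : mspan 0
| mspan_cons c al be a : mspan a -> mspan (c *: mon al be + a).

Lemma mspanD a b : mspan a -> mspan b -> mspan (a + b).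
Proof.
by move=> + bS; elim=> [|c al be a' _ IH]; rewrite ?add0r // -addrA; constructor.
Qed.

Lemma mspanZ c a : mspan a -> mspan (c *: a).
Proof.
elim=> [|d al be a' _ IH]; first by rewrite scaler0; constructor.
by rewrite scalerDr scalerA; constructor.
Qed.

Lemma mspan_mon al be : mspan (mon al be).
Proof. by rewrite -[mon _ _]scale1r -[_ *: _]addr0; constructor; constructor. Qed.

Lemma mspan_star a : mspan a -> mspan (star a).
Proof.
elim=> [|d al be a' _ IH]; first by rewrite star0; constructor.
by rewrite starD starZ starM starK; constructor.
Qed.

Lemma mspanM a b : mspan a -> mspan b -> mspan (a * b).
Proof.
move=> aS bS; elim: aS => [|c al be a' _ IH]; first by rewrite mul0r; constructor.
rewrite mulrDl -scalerAl; apply: mspanD IH; apply: mspanZ.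
elim: bS => [|d ga de b' _ IH]; first by rewrite mulr0; constructor.
rewrite mulrDr -scalerAr; apply: mspanD IH; apply: mspanZ.
have [e _ ->] := monomialM s_iso s_qcomm star_qcomm al be ga de.
exact/mspanZ/mspan_mon.
Qed.

Hypothesis dense : cstar_generated s.

Lemma mspan_dense a (e : R) : 0 < e -> exists2 b, mspan b & cnorm (a - b) < e.
Proof.
apply: dense => [|x y|x y|c x|x|i].
- have := mspan_mon (fun=> 0%N) (fun=> 0%N).
  by rewrite !mono0 // star1 mulr1.
- exact: mspanD.
- exact: mspanM.
- exact: mspanZ.
- exact: mspan_star.
have := mspan_mon (fun j => j == i) (fun=> 0%N).
rewrite [mono s (fun=> 0%N)]mono0 // star1 mulr1; congr mspan.
have H (r : seq 'I_n) : \prod_(j <- r) s j ^+ (j == i) = s i ^+ count_mem i r.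
  elim: r => [|j r IH]; first by rewrite big_nil.
  rewrite big_cons IH /=; have [->|_] := eqVneq j i; first by rewrite exprD.
  by rewrite expr0 mul1r.
by rewrite /mono H count_uniq_mem ?index_enum_uniq // mem_index_enum.
Qed.

(** On the span of the monomials the corner maps are eventually constant; contractivity and density
    extend the limit to A. The coefficient of D is determined by the limit and bounded by its norm
    because ||D|| = 1. *)
Lemma corner_state : D <> 0 -> exists2 tau : {scalar A}, fpos tau &
  forall al be, tau (mon al be) = (diagonal al be)%:R.
Proof.
move=> Dn0.
have /choice[L LP] : forall N, exists L, posmap L /\
    forall al be, (degree al < N)%N -> (degree be < N)%N ->
      L (mon al be) = (diagonal al be)%:R *: D.
  by move=> N; have [M Mp ME] := corner_map N; exists M.
have Ll N : linear (L N) by case: (LP N) => -[].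
have Lc N a : cnorm (L N a) <= cnorm a by case: (LP N) => -[].
have L0 N : L N 0 = 0 by have := Ll N (-1) 0 0; rewrite scaler0 addr0 scaleN1r addNr.
have LB N a b : L N (a - b) = L N a - L N b.
  by rewrite addrC -scaleN1r Ll scaleN1r addrC.
have dE : cnorm D = 1.
  have := cnorm_cstar D; rewrite star_defect_defect expr2 => /eqP.
  rewrite -{1}[cnorm D]mulr1 -subr_eq0 -mulrBr mulf_eq0 subr_eq0 => /orP[/eqP/cnorm_eq0//|/eqP //].
pose lim a c := ccvg (fun N => L N a) (c *: D).
have ex_span a : mspan a -> exists c, lim a c.
  move=> aS; suff [c [N0 H]] : exists c N0, forall N, (N0 <= N)%N -> L N a = c *: D.
    by exists c => e e0; exists N0 => N /H->; rewrite subrr cnorm0.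
  elim: aS => [|d al be b _ [c [N0 H]]].
    by exists 0, 0%N => N _; rewrite L0 scale0r.
  exists (d * (diagonal al be)%:R + c).
  exists (maxn N0 (maxn (degree al).+1 (degree be).+1)) => N.
  rewrite !geq_max => /and3P[/H bE aN bN].
  by rewrite Ll bE (LP N).2 // scalerDl scalerA.
have lim_dist a b c d : lim a c -> lim b d -> cabs (c - d) <= cnorm (a - b).
  move=> ac bd; rewrite -[cabs _]mulr1 -dE -cnormZ scalerBl.
  apply: (ccvg_cnorm_le (u := fun N => L N a - L N b)); last exact: ccvgB.
  by move=> N; rewrite -LB.
have ex a : exists c, lim a c.
  have /choice[b bP] : forall k, exists b, mspan b /\ cnorm (a - b) < rate R k / 2.
    move=> k; have [|b bS ab] := @mspan_dense a (rate R k / 2); last by exists b.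
    by rewrite !divr_gt0.
  have /choice[c cP] : forall k, exists c, lim (b k) c.
    by move=> k; exact: ex_span (bP k).1.
  have [|d dP] := @complex_cauchy_rate R c.
    move=> k p; apply: le_trans (lim_dist _ _ _ _ (cP _) (cP _)) _.
    apply: le_trans (cnorm_dist _ a _) _; rewrite cnormB.
    have rk : rate R (k + p) <= rate R k.
      by elim: p => [|p IH]; rewrite ?addn0 // addnS (le_trans (rateS_le _ _)).
    by have := (bP k).2; have := (bP (k + p)%N).2; lra.
  (* The errors add up to less than [rate M] / 2 + e/4 + 2 [rate M], hence e/4 as the threshold. *)
  exists d => e e0; have [M MP] := @rate_small R (e / 4%:R) (divr_gt0 e0 (ltr0Sn _ _)).
  have {}MP := MP M (leqnn M).
  have [N NP] := cP M (e / 4%:R) (divr_gt0 e0 (ltr0Sn _ _)).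
  exists N => m /NP h1.
  apply: le_lt_trans (cnorm_dist _ (L m (b M)) _) _.
  have h2 := Lc m (a - b M); rewrite LB in h2.
  have := cnorm_dist (L m (b M)) (c M *: D) (d *: D).
  rewrite -scalerBl cnormZ dE mulr1; have := dP M; have := (bP M).2; lra.
have [tau tauP] := choice ex.
have uniq_lim a c d : lim a c -> lim a d -> c = d.
  move=> ac ad; have := lim_dist _ _ _ _ ac ad; rewrite subrr cnorm0 => h.
  apply/eqP; rewrite -subr_eq0 -normr_eq0 -cabs_norm; apply/eqP.
  by congr (_%:C); apply: le_anti; rewrite h cabs_ge0.
have tau_lin : linear_for *%R tau.
  move=> c a b; apply: uniq_lim (tauP _) _.
  rewrite /lim scalerDl -scalerA.
  have := ccvgD (ccvgZ c (tauP a)) (tauP b).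
  by move=> H e /H[N NP]; exists N => m /NP; rewrite Ll.
pose tauL := GRing.isLinear.Build _ _ _ _ tau tau_lin.
pose tau' : {scalar A} := HB.pack tau tauL.
exists tau' => [a ap|al be] /=.
  have h : cpos (tau a *: D).
    by apply: ccvg_cpos (tauP a) => N; case: (LP N) => -[_ Lp _] _; exact: Lp.
  have Dp : cpos D by rewrite -star_defect_defect; exact: cpos_star_mul.
  have tr : (tau a)^* = tau a.
    have := cpos_sa h; rewrite starZ star_defect // => /eqP.
    rewrite -subr_eq0 -scalerBl scaler_eq0 subr_eq0 => /orP[/eqP //|/eqP //].
  have /complex_realP[r rE] : tau a \is Num.real by apply/CrealP.
  rewrite rE -(rmorph0 (real_complex R)) lecR leNgt; apply/negP => r0.
  (* A negative value r would make r D, hence - D, positive along with D. *)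
  apply: Dn0; apply: (cpos_antisym Dp).
  have rN : 0 <= - r^-1 by rewrite oppr_ge0 invr_le0 ltW.
  have := cposZ rN h; rewrite rE scalerA -rmorphM mulNr mulVf ?lt_eqF //.
  by rewrite rmorphN1 scaleN1r.
apply: uniq_lim (tauP _) _ => e e0.
exists (maxn (degree al).+1 (degree be).+1) => N; rewrite geq_max => /andP[aN bN].
by rewrite (LP N).2 // subrr cnorm0.
Qed.

End GaugeState.

(** * Compression to blocks *)

Section CoordinateAverage.

Variables (R : realType) (A : cstarAlgType R) (n : nat) (s : 'I_n -> A).
Hypothesis s_iso : forall i, star (s i) * s i = 1.
Hypothesis s_qcomm : forall i j, qcomm (s i) (s j).
Hypothesis star_qcomm : forall i j, i != j -> qcomm (star (s i)) (s j).

Local Notation rp := (rproj s).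
Local Notation sp := (sproj s).

Lemma cnorm_rproj i c : cnorm (rp i c) <= 1.
Proof.
by apply: cnorm_proj_le; rewrite star_rproj // rprojM // maxnn.
Qed.

Lemma sum_sproj i m M : (m <= M)%N ->
  \sum_(g < M) ((g < m)%N%:R : R)%:C *: sp i g = 1 - rp i m.
Proof.
move=> mM; transitivity (\sum_(g < m) sp i g).
  rewrite (big_ord_widen _ (fun g => sp i g) mM) [RHS]big_mkcond.
  by apply: eq_bigr => g _; case: (_ < _)%N; rewrite ?scale1r ?scale0r.
elim: m {mM} => [|m IH]; first by rewrite big_ord0 rproj0 subrr.
by rewrite big_ord_recr /= IH addrA subrK.
Qed.

Lemma sum_interval x y M : (\sum_(g < M) nat_of_bool (x <= g < y) = minn M y - x)%N.
Proof. by elim: M => [|M IH]; [rewrite big_ord0|rewrite big_ord_recr /= IH]; lia. Qed.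

(** Moving a window of N consecutive projections by one step changes its sum by two end terms only,
    whatever N is. *)
Lemma sum_rproj_shift i x d N :
  cnorm (\sum_(c < N) (rp i (x + c) - rp i (x + c + d))) <= (2 * d)%N%:R.
Proof.
elim: d => [|d IH].
  rewrite big1 ?cnorm0 // => c _; by rewrite addn0 subrr.
have -> : \sum_(c < N) (rp i (x + c) - rp i (x + c + d.+1)) =
    \sum_(c < N) (rp i (x + c) - rp i (x + c + d)) + (rp i (x + d) - rp i (x + d + N)).
  have -> : rp i (x + d) - rp i (x + d + N) =
      \sum_(c < N) (rp i (x + c + d) - rp i (x + c + d.+1)).
    elim: N {IH} => [|N IH]; first by rewrite big_ord0 addn0 subrr.
    rewrite big_ord_recr /= -IH addrA (_ : x + N + d = x + d + N)%N; last lia.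
    by rewrite subrK (_ : x + N + d.+1 = x + d + N.+1)%N //; lia.
  by rewrite -big_split; apply: eq_bigr => c _; rewrite /= addrA subrK.
apply: le_trans (cnormD _ _) _; rewrite mulnS [(2 + _)%N]addnC natrD lerD //.
have := cnorm_sub (rp i (x + d)) (rp i (x + d + N)).
by have := cnorm_rproj i (x + d); have := cnorm_rproj i (x + d + N); lra.
Qed.

Variable N : nat.
Hypothesis N0 : (0 < N)%N.

(* One coordinate of a block: the cut 2N + c, the side of the cut (true: below
   it, where s_i is compressed to a finite matrix; false: above it, where s_i is
   treated as a unitary), and a position g. *)
Definition coord := ('I_N * bool * 'I_(3 * N))%type.

Definition cut (c : 'I_N) := (2 * N + c)%N.

Definition admissible (L : 'I_N * bool) (g : nat) :=
  if L.2 then (g < cut L.1)%N else (N <= g < 2 * N)%N.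

Definition weight (L : 'I_N * bool) : R := N%:R^-1 * (if L.2 then 1 else N%:R^-1).

(** Both g and the position to which s_i^a s_i^b^* moves it must be admissible. Below the cut the
    truncated difference retains the g < b: their [sproj] is killed by s_i^b^*, and retaining them
    makes the sum of the [sproj] telescope from 1. *)
Definition coord_coef a b (k : coord) : R :=
  (admissible k.1 k.2 && admissible k.1 (k.2 - b + a))%:R * weight k.1.

(** Above the cut, the maximum comes from a product of three range projections: that of the cut
    after its passage through s_i^a s_i^b^*, that of the position, and that of the cut. *)
Definition coord_proj a b i (k : coord) : A :=
  if k.1.2 then sp i k.2
  else rp i (maxn (maxn (cut k.1.1 - a + b) k.2) (cut k.1.1)).

Definition coord_avg i a b : A :=
  \sum_(k : coord) (coord_coef a b k)%:C *: coord_proj a b i k.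

(** For each cut the lower side sums to 1 - [rproj] at lo and the upper side to rho times [rproj] at
    hi, where hi - lo = |a - b|. Over the N cuts the mismatch telescopes to at most 2 (a + b)/N, and
    1 - rho costs at most (a + b)/N. *)
Lemma coord_avg_near1 i a b : (a + b <= N)%N ->
  cnorm (1 - coord_avg i a b) <= 3%:R * (a + b)%N%:R / N%:R.
Proof.
move=> abN; have Np : (0 : R) < N%:R by rewrite ltr0n.
(* The proportion of the positions in [N, 2N) that remain there under g -> g - b + a. *)
pose rho : R := (\sum_(g < 3 * N)
  nat_of_bool ((N <= g < 2 * N) && (N <= g - b + a < 2 * N)))%N%:R / N%:R.
have rho1 : rho <= 1.
  rewrite ler_pdivrMr // mul1r ler_nat.
  apply: leq_trans (_ : \sum_(g < 3 * N) nat_of_bool (N <= g < 2 * N) <= _)%N.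
    by apply: leq_sum => g _; lia.
  by rewrite sum_interval; lia.
have rho2 : 1 - rho <= (a + b)%N%:R / N%:R.
  rewrite lerBlDr -mulrDl ler_pdivlMr // mul1r -natrD ler_nat.
  apply: leq_trans (_ : a + b + \sum_(g < 3 * N) nat_of_bool (N + b <= g < 2 * N - a) <= _)%N.
    by rewrite sum_interval; lia.
  by rewrite leq_add2l; apply: leq_sum => g _; lia.
pose lo (c : 'I_N) := minn (cut c) (cut c - a + b).
pose hi (c : 'I_N) := maxn (cut c - a + b) (cut c).
have avgE : coord_avg i a b =
    \sum_c N%:R^-1%:C *: ((1 - rp i (lo c)) + rho%:C *: rp i (hi c)).
  rewrite /coord_avg sum_pair sum_pair; apply: eq_bigr => c _.
  rewrite big_bool scalerDr /=; congr (_ + _).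
    rewrite -(@sum_sproj i _ (3 * N)); last by have := ltn_ord c; rewrite /lo /cut; lia.
    rewrite scaler_sumr; apply: eq_bigr => g _.
    rewrite scalerA -rmorphM /coord_coef /coord_proj /admissible /weight /= mulr1 mulrC.
    congr ((_ * _%:R)%:C *: _); congr nat_of_bool; rewrite /lo /cut; lia.
  rewrite /rho scalerA -rmorphM natr_sum mulr_suml mulr_sumr rmorph_sum scaler_suml.
  apply: eq_bigr => g _; rewrite /coord_coef /coord_proj /admissible /weight /=.
  case: andP => [[g1 g2]|_]; last by rewrite mulr0n !mul0r mulr0 !scale0r.
  rewrite (_ : maxn _ (cut c) = hi c); last by rewrite /hi /cut; lia.
  by rewrite mulr1n !mul1r.
have oneE : 1 = \sum_(c < N) N%:R^-1%:C *: (1 : A).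
  rewrite sumr_const card_ord -scaler_nat scalerA -(rmorph_nat (real_complex R)).
  by rewrite -rmorphM mulfV ?gt_eqF // scale1r.
have -> : 1 - coord_avg i a b =
    N%:R^-1%:C *: (\sum_c (rp i (lo c) - rp i (hi c))) +
    ((1 - rho) * N%:R^-1)%:C *: (\sum_c rp i (hi c)).
  rewrite avgE {1}oneE -sumrB !scaler_sumr -big_split; apply: eq_bigr => c _ /=.
  rewrite [(1 - rho) * _]mulrC [(_ * (1 - rho))%:C]rmorphM -scalerA -scalerBr.
  rewrite -[RHS]scalerDr; congr (_ *: _).
  rewrite rmorphB rmorph1 scalerBl scale1r [RHS]addrA subrK.
  by rewrite opprD addrA opprB [1 + (_ - 1)]addrC subrK.
have hi_le : cnorm (\sum_c rp i (hi c)) <= N%:R.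
  apply: le_trans (cnorm_sum _ _ _) _.
  apply: le_trans (ler_sum _ (fun c _ => cnorm_rproj i (hi c))) _.
  by rewrite sumr_const card_ord.
have lo_le : cnorm (\sum_c (rp i (lo c) - rp i (hi c))) <= 2 * (a + b)%N%:R.
  rewrite -natrM; have [ab|/ltnW ba] := leqP a b.
    rewrite (_ : \sum_c _ = \sum_(c < N) (rp i (2 * N + c) - rp i (2 * N + c + (b - a)))).
      by apply: le_trans (sum_rproj_shift _ _ _ _) _; rewrite ler_nat; lia.
    apply: eq_bigr => c _; congr (rp i _ - rp i _); rewrite /lo /hi /cut; lia.
  rewrite (_ : \sum_c _ = \sum_(c < N)
      (rp i (2 * N - (a - b) + c) - rp i (2 * N - (a - b) + c + (a - b)))).
    by apply: le_trans (sum_rproj_shift _ _ _ _) _; rewrite ler_nat; lia.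
  apply: eq_bigr => c _; congr (rp i _ - rp i _); rewrite /lo /hi /cut; lia.
apply: le_trans (cnormD _ _) _; rewrite !cnormR ger0_norm ?invr_ge0 //.
rewrite ger0_norm ?mulr_ge0 ?invr_ge0 ?subr_ge0 //.
have -> : 3%:R * (a + b)%N%:R / N%:R = N%:R^-1 * (2 * (a + b)%N%:R) + (a + b)%N%:R / N%:R :> R.
  by field; rewrite gt_eqF.
apply: lerD; first by rewrite ler_wpM2l ?invr_ge0.
apply: le_trans (_ : (1 - rho) * N%:R^-1 * N%:R <= _).
  by rewrite ler_wpM2l // mulr_ge0 ?invr_ge0 ?subr_ge0.
by rewrite mulfVK ?gt_eqF.
Qed.

Lemma coord_avg0 i : coord_avg i 0 0 = 1.
Proof.
have := coord_avg_near1 i (leq0n N : (0 + 0 <= N)%N); rewrite mulr0 mul0r => h.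
apply/eqP; rewrite eq_sym -subr_eq0; apply/eqP/cnorm_eq0/le_anti.
by rewrite h cnorm_ge0.
Qed.

End CoordinateAverage.

(** * Rows, blocks and the reconstruction of monomials *)

Section Blocks.

Variables (R : realType) (A : cstarAlgType R) (n : nat) (s : 'I_n -> A).
Hypothesis s_iso : forall i, star (s i) * s i = 1.
Hypothesis s_qcomm : forall i j, qcomm (s i) (s j).
Hypothesis star_qcomm : forall i j, i != j -> qcomm (star (s i)) (s j).

Implicit Types (al be : 'I_n -> nat).

Local Notation mon al be := (mono s al * star (mono s be)).
Local Notation rp := (rproj s).
Local Notation sp := (sproj s).

(** The defect vanishes for instance when some s_i with i in J is unitary. The zero functional then
    stands in for the state, and the rows of such blocks vanish. *)
Definition state_for (J : pred 'I_n) (tau : {scalar A}) := fpos tau /\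
  ((forall al be, tau (mon al be) = (diagonal J al be)%:R) \/
   defect s J = 0 /\ forall a, tau a = 0).

Section State.

Variables (J : pred 'I_n) (tau : {scalar A}).
Hypothesis tauE : forall al be, tau (mon al be) = (diagonal J al be)%:R.

Lemma tau_orth f g : tau (star (mono s f) * mono s g) = [forall i, f i == g i]%:R.
Proof.
have [/forallP fg|nfg] := boolP [forall i, f i == g i].
  have fgE : mono s f = mono s g by apply: eq_mono => i; exact/eqP.
  rewrite fgE iso_mono //.
  have := tauE (fun=> 0%N) (fun=> 0%N); rewrite mono0 // star1 mulr1 => ->.
  by congr (_%:R); apply/eqP; rewrite eqb1; apply/forallP => i; rewrite eqxx implybT.
have [c _ ->] := star_mono_mono s_iso s_qcomm star_qcomm f g.
rewrite linearZ tauE; suff /negPf-> : ~~ diagonal J (fun i => g i - f i)%N (fun i => f i - g i)%N.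
  by rewrite /= mulr0.
apply: contra nfg => /forallP H; apply/forallP => i.
by have /andP[/eqP] := H i; lia.
Qed.

Lemma tau_kill f x y i : J i -> (0 < y i)%N ->
  tau (star (mono s f) * mon x y) = 0.
Proof.
move=> Ji yi.
have [c _] := monomialM s_iso s_qcomm star_qcomm (fun=> 0%N) f x y.
rewrite mono0 // mul1r => ->; rewrite linearZ tauE.
suff /negPf-> : ~~ diagonal J (fun i => 0 + (x i - f i))%N (fun i => y i + (f i - x i))%N.
  by rewrite /= mulr0.
by apply/negP => /forallP /(_ i); rewrite Ji /=; lia.
Qed.

End State.

Variable N : nat.
Hypothesis N0 : (0 < N)%N.

Local Notation label := {ffun 'I_n -> 'I_N * bool}.
Local Notation index := {ffun 'I_n -> coord N}.
Implicit Types (G F : index) (L : label).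

Definition lab G : label := [ffun i => (G i).1].
Definition pos G i : nat := (G i).2.
Definition side L : pred 'I_n := fun i => (L i).2.

(** With zero exponents this is the projection above the cuts on the upper sides; al and be record
    its passage through s^al s^be^*, as in [upper_mon]. *)
Definition upper L al be : A := \prod_(i < n)
  (if side L i then 1 else rp i (cut (L i).1 - al i + be i)).

Definition valid al be G :=
  [forall i, admissible (lab G i) (pos G i - be i + al i)].

Definition lweight L : R := \prod_(i < n) weight R (L i).

(* The rows V with expand M = V M V^*, one for each block [lab G] and position. *)
Definition row G : A := if valid (fun=> 0%N) (fun=> 0%N) G
  then (Num.sqrt (lweight (lab G)))%:C *:
    (upper (lab G) (fun=> 0%N) (fun=> 0%N) * mono s (pos G) * defect s (side (lab G)))
  else 0.

Local Notation upper0 L := (upper L (fun=> 0%N) (fun=> 0%N)).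
Local Notation valid0 G := (valid (fun=> 0%N) (fun=> 0%N) G).

Lemma upper_mon L al be : upper0 L * mon al be = mon al be * upper L al be.
Proof.
rewrite /upper; elim: (index_enum _) => [|i r IH]; first by rewrite !big_nil mulr1 mul1r.
rewrite !big_cons -mulrA IH mulrA [RHS]mulrA; congr (_ * _).
by case: (side L i); rewrite ?mulr1 ?mul1r // subn0 addn0 rproj_monomial.
Qed.

Lemma star_upper L al be : star (upper L al be) = upper L al be.
Proof.
rewrite /upper; elim: (index_enum _) => [|i r IH]; first by rewrite !big_nil star1.
rewrite !big_cons starM IH; symmetry.
have -> : star (if side L i then 1 else rp i (cut (L i).1 - al i + be i)) =
    if side L i then 1 else rp i (cut (L i).1 - al i + be i).
  by case: (side L i); rewrite ?star1 // star_rproj.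
apply: commr_prod => j _; case: (side L i); case: (side L j);
  rewrite /GRing.comm ?mulr1 ?mul1r //; exact: rproj_comm.
Qed.

Lemma lweight_ge0 L : 0 <= lweight L.
Proof.
apply: prodr_ge0 => i _; rewrite /weight; case: (L i).2.
  by rewrite mulr1 invr_ge0.
by rewrite mulr_ge0 ?invr_ge0.
Qed.

(** All the projections involved commute, so the term splits into one factor per coordinate; in
    [block_sum] the sum over blocks then becomes a product of one-coordinate averages. *)
Lemma block_term G al be :
  ((valid0 G && valid al be G)%:R * lweight (lab G))%:C *:
    (upper0 (lab G) * mon al be * (mono s (pos G) * defect s (side (lab G)) *
      star (mono s (pos G))) * upper0 (lab G)) =
  mon al be * \prod_(i < n) ((coord_coef R (al i) (be i) (G i))%:C *:
    coord_proj s (al i) (be i) i (G i)).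
Proof.
have coefE : (valid0 G && valid al be G)%:R * lweight (lab G) =
    \prod_(i < n) coord_coef R (al i) (be i) (G i).
  rewrite /coord_coef big_split /=; congr (_ * _); last first.
    by apply: eq_bigr => i _; rewrite ffunE.
  have [/andP[/forallP v0 /forallP v1]|] := boolP (_ && _).
    rewrite big1 // => i _; have := v0 i; have := v1 i.
    by rewrite !ffunE subn0 addn0 /pos => -> ->.
  rewrite negb_and !negb_forall => /orP[] /existsP[j /negPf vj];
    rewrite (bigD1 j) //= -?/(pos G j); rewrite ffunE ?subn0 ?addn0 in vj.
    by rewrite vj mul0r.
  by rewrite vj andbF mul0r.
rewrite coefE scaler_prod -rmorph_prod -scalerAr; congr (_ *: _).
rewrite mono_defect_star_mono // upper_mon -2!mulrA -mulrA mulrA; congr (_ * _).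
rewrite /upper mulrA -prodrM_comm => [|i j _ _]; last first.
  case: (side _ i); first by rewrite /GRing.comm mulr1 mul1r.
  by case: (side _ j); [exact/commr_sym/sproj_rproj_comm|exact: rproj_comm].
rewrite -prodrM_comm => [|i j _ _]; last first.
  case: (side (lab G) j); first by rewrite /GRing.comm mulr1 mul1r.
  apply/commr_sym; apply: commrM; first by
    case: (side _ i); [exact: commr1|exact: rproj_comm].
  by case: (side _ i); [exact/commr_sym/sproj_rproj_comm|exact: rproj_comm].
apply: eq_bigr => i _; rewrite /side /coord_proj !ffunE /pos.
case: (G i).1.2; first by rewrite mulr1 mul1r.
by rewrite subn0 addn0 !rprojM.
Qed.

Lemma block_sum al be :
  \sum_G ((valid0 G && valid al be G)%:R * lweight (lab G))%:C *:
    (upper0 (lab G) * mon al be * (mono s (pos G) * defect s (side (lab G)) *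
      star (mono s (pos G))) * upper0 (lab G)) =
  mon al be * \prod_(i < n) coord_avg s N i (al i) (be i).
Proof.
under eq_bigr do rewrite block_term.
rewrite -mulr_sumr; congr (_ * _).
by rewrite /coord_avg bigA_distr_bigA.
Qed.

Lemma row_mul F G a : lab F = lab G -> row F * a * star (row G) =
  ((valid0 F && valid0 G)%:R * lweight (lab G))%:C *:
    (upper0 (lab G) * (mono s (pos F) * defect s (side (lab G)) * a *
      (defect s (side (lab G)) * star (mono s (pos G)))) * upper0 (lab G)).
Proof.
move=> FG; rewrite /row FG.
case: (valid0 F); last by rewrite !mul0r scale0r.
case: (valid0 G); last by rewrite star0 mulr0 mul0r scale0r.
rewrite mul1r starR [star (_ * defect _ _)]starM star_defect //.
rewrite [star (upper _ _ _ * _)]starM star_upper.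
rewrite -!scalerAl -scalerAr scalerA -rmorphM -expr2 sqr_sqrtr ?lweight_ge0 //.
by rewrite !mulrA.
Qed.

Lemma row_one : \sum_G row G * star (row G) = 1.
Proof.
have := block_sum (fun=> 0%N) (fun=> 0%N).
have -> : \prod_(i < n) coord_avg s N i 0 0 = 1.
  by apply: big1 => i _; exact: coord_avg0.
rewrite mono0 // star1 !mulr1 => <-; apply: eq_bigr => G _.
rewrite -{1}[row G]mulr1 row_mul // !mulr1; congr (_ *: (_ * _ * _)).
by rewrite mulrA -[_ * defect _ _ * defect _ _]mulrA defect_idem.
Qed.

Variable tau : label -> {scalar A}.
Hypothesis tauP : forall L, state_for (side L) (tau L).

Lemma row_gram L (c : index -> R[i]) :
  tau L (star (\sum_(F | lab F == L) c F *: mono s (pos F)) *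
    \sum_(F | lab F == L) c F *: mono s (pos F)) <=
  \sum_(F | lab F == L) Num.conj (c F) * c F.
Proof.
have [tp [tE|[_ t0]]] := tauP L; last first.
  rewrite t0; apply: sumr_ge0 => F _; rewrite mulrC; exact: mul_conjC_ge0.
rewrite star_sum mulr_suml linear_sum; apply: ler_sum => F /eqP FL.
rewrite mulr_sumr linear_sum (bigD1 F) ?FL //= big1 ?addr0 => [|G /andP[/eqP GL GF]].
  rewrite starZ -scalerAl -scalerAr !linearZ /= (tau_orth tE).
  by rewrite (_ : [forall i, _]) ?mulr1 //; apply/forallP => i.
rewrite starZ -scalerAl -scalerAr !linearZ /= (tau_orth tE).
rewrite (_ : [forall i, _] = false) ?mulr0 //; apply/negbTE.
apply: contra GF => /forallP FG; apply/eqP/ffunP => i.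
have := congr1 (fun M : label => M i) (etrans GL (esym FL)); rewrite !ffunE => e1.
have /eqP e2 := FG i; rewrite /pos in e2.
by rewrite (surjective_pairing (G i)) (surjective_pairing (F i)) e1; congr (_, _); apply: val_inj.
Qed.

(** For fixed G, s^al s^be^* moves s^g to a phase times s^h with h = g - be + al. By orthonormality
    at most one F contributes, and its coefficient carries the very phase needed to restore s^al
    s^be^* s^g. *)
Lemma row_reconstruct G al be : (forall i, be i <= N)%N ->
  \sum_F (tau (lab F) (star (mono s (pos F)) * mon al be * mono s (pos G)) *+
      (lab F == lab G)) *: (row F * star (row G)) =
  ((valid0 G && valid al be G)%:R * lweight (lab G))%:C *:
    (upper0 (lab G) * mon al be * (mono s (pos G) * defect s (side (lab G)) *
      star (mono s (pos G))) * upper0 (lab G)).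
Proof.
move=> beN; set L := lab G; set D := defect s (side L); set g := pos G.
pose h i := (g i - be i + al i)%N.
transitivity (\sum_(F | lab F == L)
    tau L (star (mono s (pos F)) * mon al be * mono s g) *: (row F * star (row G))).
  rewrite [RHS]big_mkcond; apply: eq_bigr => F _.
  by case: eqP => [->|_]; rewrite ?mulr1n // mulr0n scale0r.
have rowE F : lab F = L -> row F * star (row G) =
    ((valid0 F && valid0 G)%:R * lweight L)%:C *:
    (upper0 L * (mono s (pos F) * D * star (mono s g)) * upper0 L).
  move=> FL; rewrite -{1}[row F]mulr1 row_mul // -/L -/D mulr1.
  congr (_ *: (_ * _ * _)).
  by rewrite mulrA -[_ * D * D]mulrA defect_idem.
have [v0|nv0] := boolP (valid0 G); last first.
  by rewrite mul0r scale0r big1 // => F _; rewrite {2}/row (negPf nv0) star0 mulr0 scaler0.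
have vG := forallP v0.
(* A zero defect makes both sides 0, since D is a factor of the rows; otherwise [state_for] gives
   the values of tau on monomials. *)
have [D0|Dn0] := eqVneq D 0.
  rewrite big1 => [|F /eqP FL]; last first.
    by rewrite rowE // D0 mulr0 !mul0r mulr0 mul0r scaler0 scaler0.
  by rewrite D0 mulr0 mul0r mulr0 mul0r scaler0.
have [tp [tE|[De _]]] := tauP L; last by rewrite /D De eqxx in Dn0.
have [c c1 cE] := star_mono_mono s_iso s_qcomm star_qcomm be g.
have [d d1 dE] := monoM s_qcomm al (fun i => g i - be i)%N.
have aG : mon al be * mono s g = (c * d) *: mon h (fun i => be i - g i)%N.
  rewrite -mulrA cE -scalerAr mulrA dE -scalerAl scalerA; congr (_ *: (_ * _)).
  by apply: eq_mono => i; rewrite addnC.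
(* be_j > g_j forces the lower side at j, since upper positions are at least N >= be_j. A power of
   s_j^* is then left over, and it is killed by D on the right side and by tau on the left. *)
have [/forallP bg|] := boolP [forall i, be i <= g i]%N; last first.
  rewrite negb_forall => /existsP[j]; rewrite -ltnNge => gj.
  have Jj : side L j.
    have := vG j; rewrite /admissible -/L -/g /side /=; case: (L j).2 => //.
    by have := beN j; lia.
  have pj : (0 < be j - g j)%N by rewrite subn_gt0.
  have z : mon al be * (mono s g * D * star (mono s g)) = 0.
    rewrite !mulrA aG -!scalerAl -!mulrA [star (mono _ _) * (D * _)]mulrA.
    by rewrite (star_mono_defect0 s_iso s_qcomm star_qcomm Jj pj) mul0r mulr0 scaler0.
  rewrite -[upper0 L * _ * _]mulrA z mulr0 mul0r scaler0 big1 // => F _.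
  by rewrite -mulrA aG -scalerAr linearZ /= (tau_kill tE _ _ Jj pj) mulr0 scale0r.
have {}aG : mon al be * mono s g = (c * d) *: mono s h.
  rewrite aG [mono s (fun i => be i - g i)%N]mono0 ?star1 ?mulr1 // => i.
  by apply/eqP; rewrite subn_eq0.
have tauF F : tau L (star (mono s (pos F)) * mon al be * mono s g) =
    (c * d) * [forall i, pos F i == h i]%:R.
  by rewrite -mulrA aG -scalerAr linearZ /= (tau_orth tE).
(* The functional sees only an F with position h; if h is not admissible, the row of that F is 0. *)
have [/forallP vh|nvh] := boolP (valid al be G); last first.
  rewrite mulr0n mul0r scale0r big1 // => F /eqP FL.
  rewrite tauF; case: forallP => [Fh|_]; last by rewrite mulr0 scale0r.
  suff nF : ~~ valid0 F by rewrite {1}/row (negPf nF) mul0r scaler0.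
  apply: contra nvh => /forallP vF; apply/forallP => i.
  by have := vF i; rewrite FL (eqP (Fh i)) subn0 addn0.
have h3 i : (h i < 3 * N)%N.
  have := vh i; rewrite /admissible -/L -/(h i); case: (L i).2; last by lia.
  by rewrite /cut; have := ltn_ord (L i).1; lia.
pose F0 : index := [ffun i => (L i, Ordinal (h3 i))].
have F0L : lab F0 = L by apply/ffunP => i; rewrite !ffunE.
have F0h i : pos F0 i = h i by rewrite /pos ffunE.
rewrite (bigD1 F0) ?F0L //= [X in _ + X]big1 => [|F /andP[/eqP FL FF0]]; last first.
  rewrite tauF (_ : [forall i, _] = false) ?mulr0 ?scale0r //; apply/negbTE.
  apply: contra FF0 => /forallP Fh; apply/eqP/ffunP => i.
  have := congr1 (fun M : label => M i) (etrans FL (esym F0L)); rewrite !ffunE /= => e1.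
  rewrite (surjective_pairing (F i)) e1; congr (_, _); apply: val_inj => /=.
  exact/eqP/Fh.
rewrite addr0 tauF (_ : [forall i, _]); last by apply/forallP => i; rewrite F0h.
have vF0 : valid0 F0.
  by apply/forallP => i; have := vh i; rewrite F0L F0h subn0 addn0.
rewrite mulr1 rowE // vF0 v0 !andbT scalerA mulrC -scalerA; congr (_ *: _).
rewrite scalerAl scalerAr -[_ *: _]/(_ *: _) (eq_mono s F0h).
by rewrite -!mulrA; congr (_ * _); rewrite !mulrA aG -!scalerAl.
Qed.

End Blocks.

(** * Nuclearity *)

Section TwistedIsometries.

Variables (R : realType) (A : cstarAlgType R) (n : nat) (s : 'I_n -> A).
Hypothesis s_iso : forall i, star (s i) * s i = 1.
Hypothesis s_qcomm : forall i j, qcomm (s i) (s j).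
Hypothesis star_qcomm : forall i j, i != j -> qcomm (star (s i)) (s j).
Hypothesis gauge : forall w : 'I_n -> R[i], (forall i, `|w i| = 1) ->
  exists f : {lrmorphism A -> A},
    (forall x, f (star x) = star (f x)) /\ (forall i, f (s i) = w i *: s i).
Hypothesis dense : cstar_generated s.

Local Notation mon al be := (mono s al * star (mono s be)).

Lemma state_exists J : exists tau : {scalar A}, state_for s J tau.
Proof.
have [D0|/eqP Dn0] := eqVneq (defect s J) 0.
  have zlin : linear_for *%R (fun _ : A => 0 : R[i]).
    by move=> c a b; rewrite mulr0 addr0.
  pose zL := GRing.isLinear.Build _ _ _ _ (fun _ : A => 0 : R[i]) zlin.
  pose zero : {scalar A} := HB.pack (fun _ : A => 0 : R[i]) zL.
  by exists zero; split=> [a _|]; [exact: lexx|right].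
have [tau tp tE] := corner_state s_iso s_qcomm star_qcomm gauge dense Dn0.
by exists tau; split=> //; left.
Qed.

Definition cp_factorable (T : A -> A) :=
  exists (k : nat) (phi : {linear A -> 'M[R[i]]_k}) (psi : {linear 'M[R[i]]_k -> A}),
  [/\ completely_positive (@star R A) (@cmx_star R k) phi,
      forall a : A, cmx_norm_le (phi a) (cnorm a),
      completely_positive (@cmx_star R k) (@star R A) psi,
      forall (M : 'M[R[i]]_k) (c : R), 0 <= c -> cmx_norm_le M c -> cnorm (psi M) <= c &
      forall a, T a = psi (phi a)].

Lemma approximant N : (0 < N)%N -> exists2 T, cp_factorable T &
  forall al be, (forall i, be i <= N)%N ->
    T (mon al be) = mon al be * \prod_(i < n) coord_avg s N i (al i) (be i).
Proof.
move=> N0; pose index := {ffun 'I_n -> coord N}.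
have /choice[tau tauP] : forall L : {ffun 'I_n -> 'I_N * bool},
    exists t : {scalar A}, state_for s (side L) t by move=> L; exact: state_exists.
have enumE (V : nmodType) (F : index -> V) : \sum_i F i = \sum_(i < #|index|) F (enum_val i).
  by rewrite (reindex _ (onW_bij _ (@enum_val_bij index))).
have [||| phi [psi [p1 p2 p3 p4 p5]]] := @factorization R A #|index| _
  (fun f => lab (enum_val f)) tau (fun f => mono s (pos (enum_val f)))
  (fun f => row s (enum_val f)).
- by move=> L; case: (tauP L).
- move=> L c.
  have := row_gram s_iso s_qcomm star_qcomm tauP L (fun F => c (enum_rank F)).
  rewrite big_mkcond enumE -big_mkcond [X in _ <= X]big_mkcond enumE -big_mkcond.
  by under eq_bigr do rewrite enum_valK; under [X in _ <= X]eq_bigr do rewrite enum_valK.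
- by rewrite -(row_one s_iso s_qcomm star_qcomm N0) enumE.
exists (fun a => psi (phi a)); first by exists #|index|, phi, psi; split.
move=> al be beN; rewrite p5 -block_sum //.
transitivity (\sum_F \sum_G (tau (lab F) (star (mono s (pos F)) * mon al be *
    mono s (pos G)) *+ (lab F == lab G)) *: (row s F * star (row s G))).
  by rewrite enumE; apply: eq_bigr => f _; rewrite [RHS]enumE.
rewrite exchange_big; apply: eq_bigr => G _.
exact: (row_reconstruct s_iso s_qcomm star_qcomm N0 tauP).
Qed.

Lemma coord_avg_cvg i a b : ccvg (fun M => coord_avg s M.+1 i a b) 1.
Proof.
move=> e e0; pose C : R := 3%:R * (a + b)%N%:R.
exists (maxn (a + b) (Num.bound (C / e))) => m; rewrite geq_max => /andP[abm bm].
rewrite cnormB; apply: le_lt_trans (coord_avg_near1 s_iso _ _ _ _ _) _ => //.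
  exact: leqW.
rewrite -/C ltr_pdivrMr ?ltr0n // mulrC -ltr_pdivrMr //.
apply: lt_le_trans (archi_boundP _) _.
  by rewrite divr_ge0 ?mulr_ge0 // ltW.
by rewrite ler_nat leqW.
Qed.

(** The approximants are linear and contractive, so their convergence to the identity need only be
    checked on monomials, where it is that of a finite product of coordinate averages. *)
Theorem twisted_isometries_nuclear : nuclear A.
Proof.
move=> F e e0.
have /choice[T TP] : forall M, exists T, cp_factorable T /\
    forall al be, (forall i, be i <= M.+1)%N ->
      T (mon al be) = mon al be * \prod_(i < n) coord_avg s M.+1 i (al i) (be i).
  by move=> M; have [T T1 T2] := approximant (ltn0Sn M); exists T.
have Tlin M : linear (T M).
  have [[k [phi [psi [_ _ _ _ TE]]]] _] := TP M.
  by move=> c a b; rewrite !TE !linearP.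
have Tc M a : cnorm (T M a) <= cnorm a.
  have [[k [phi [psi [_ p2 _ p4 TE]]]] _] := TP M.
  by rewrite TE; apply: p4; rewrite ?cnorm_ge0.
have Tspan a : mspan s a -> ccvg (fun M => T M a) a.
  elim=> [|c al be b _ IH].
    move=> d d0; exists 0%N => M _; have := Tlin M (-1) 0 0.
    by rewrite scaler0 addr0 scaleN1r addNr => ->; rewrite subrr cnorm0.
  have mon_cvg : ccvg (fun M => T M (mon al be)) (mon al be).
    have := ccvgMl (mon al be) (ccvg_prod (index_enum 'I_n)
      (fun i => coord_avg_cvg i (al i) (be i))).
    rewrite mulr1 => H d /H[N NP]; exists (maxn N (degree be)) => M.
    rewrite geq_max => /andP[/NP NM dM]; rewrite (TP M).2 // => i.
    exact: leq_trans (degree_le be i) (leqW dM).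
  have := ccvgD (ccvgZ c mon_cvg) IH.
  by move=> H d /H[N NP]; exists N => M /NP; rewrite Tlin.
have Tcvg a : ccvg (fun M => T M a) a.
  move=> d d0; have d3 : 0 < d / 3%:R by rewrite divr_gt0.
  have [b bS ab] := mspan_dense s_iso s_qcomm star_qcomm dense a d3.
  have [N NP] := Tspan b bS _ d3; exists N => M /NP h.
  have TB : T M a - T M b = T M (a - b).
    by rewrite addrC -scaleN1r -Tlin scaleN1r addrC.
  have := cnorm_dist (T M a) (T M b) a; have := cnorm_dist (T M b) b a.
  by have := Tc M (a - b); rewrite TB (cnormB b a); lra.
have [M MP] : exists M, forall a, a \in F -> cnorm (T M a - a) < e.
  suff [N NP] : exists N, forall M, (N <= M)%N -> forall a, a \in F -> cnorm (T M a - a) < e.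
    by exists N; exact: NP.
  elim: F => [|a F [N NP]]; first by exists 0%N.
  have [N' NP'] := Tcvg a e e0; exists (maxn N N') => M.
  rewrite geq_max => /andP[NM N'M] b; rewrite inE => /predU1P[->|]; first exact: NP'.
  exact: NP.
have [[k [phi [psi [p1 p2 p3 p4 TE]]]] _] := TP M.
by exists k, phi, psi; split=> // a aF; rewrite -TE; exact: MP.
Qed.

End TwistedIsometries.

Theorem proposition4p7 (R : realType) (n l : nat) (z : 'I_n -> 'I_n -> R[i])
    (hn : (1 <= n)%N) (hl : (l <= n)%N)
    (hz1 : forall i j : 'I_n, i != j -> `|z i j| = 1)
    (hz2 : forall i j : 'I_n, i != j -> z j i = Num.conj (z i j))
    (A : cstarAlgType R) (s : 'I_n -> A)
    (hA : is_universal_twisted l z s) :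
  nuclear A.
Proof.
have [[rel1 rel2 rel3 rel4] dense univ] := hA.
have s_iso i : star (s i) * s i = 1.
  by have [il|/rel4[]] := ltnP i l; [exact: rel3|].
apply: (twisted_isometries_nuclear s_iso _ _ _ dense) => [i j|i j ij|w w1].
- have [->|ij] := eqVneq i j; first exact: qeq_refl.
  by exists (z i j); [exact: hz1|exact: rel2].
- by exists (Num.conj (z i j)); [rewrite norm_conjC hz1|exact: rel1].
have ww i : Num.conj (w i) * w i = 1 by rewrite mulrC -normCK w1 expr1n.
(* The elements w_i s_i satisfy the same relations, because each w_i occurs equally on both sides or
   meets its conjugate; universality turns this into the gauge map. *)
have [|f [fs fE]] := univ A (fun i => w i *: s i); last by exists f.
split=> [i j ij|i j ij|i il|i il].
- by rewrite starZ -!scalerAl -!scalerAr rel1 // !scalerA; congr (_ *: _); ring.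
- by rewrite -!scalerAl -!scalerAr rel2 // !scalerA; congr (_ *: _); ring.
- by rewrite starZ -scalerAl -scalerAr scalerA ww scale1r rel3.
have [e1 e2] := rel4 i il.
split; rewrite starZ -scalerAl -scalerAr scalerA; first by rewrite ww e1 scale1r.
by rewrite mulrC ww e2 scale1r.
Qed.
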